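(* Let $W$ be a finitely generated crystallographic Coxeter group. Then an automorphism $\alpha\in\mathrm{Aut}(W)$ is inner-by-graph if and only if $\alpha$ maps every parabolic subgroup of $W$ to a parabolic subgroup of $W$.
   Context: Let $S=\{s_1,\dots,s_n\}$ be the given Coxeter generating set of $W$ and $(m_{ij})$ the corresponding Coxeter matrix ($m_{ij}$ is the order of $s_is_j$). The Coxeter group $W$ is crystallographic if $m_{ij}\in\{2,3,4,6,\infty\}$ for all $i\ne j$. A parabolic subgroup (with respect to $S$) is a subgroup conjugate in $W$ to $W_J=\langle J\rangle$ for some $J\subseteq S$. An automorphism $\alpha$ of $W$ is inner-by-graph (with respect to $S$) if $\alpha(S)=wSw^{-1}$ (as sets) for some $w\in W$; equivalently, $\alpha$ is a composition of an inner automorphism with an automorphism stabilising $S$ setwise. *)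

(* Defs.v *)
From mathcomp Require Import all_boot all_algebra.
From mathcomp Require Import classical_sets.

Set Implicit Arguments.
Unset Strict Implicit.
Unset Printing Implicit Defensive.

Local Open Scope classical_set_scope.
Local Open Scope group_scope.

(* [has_order x 0] says that [x] has infinite order, since [0 %| k] iff
   [k = 0]; thus [0] stands for infinity in a Coxeter matrix below. *)
Definition has_order (W : groupType) (x : W) (d : nat) : Prop :=
  forall k : nat, x ^+ k = 1 <-> d %| k.

Definition is_subgroup (W : groupType) (A : set W) : Prop :=
  [/\ A 1, forall x y, A x -> A y -> A (x * y) & forall x, A x -> A x^-1].

Definition generated (W : groupType) (X : set W) : set W :=
  smallest (@is_subgroup W) X.

Definition conj_set (W : groupType) (w : W) (X : set W) : set W :=
  [set w * x * w^-1 | x in X].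

(* [W] has the presentation < s_i | (s_i s_j)^(m_ij) = 1 > on distinct
   involutions [s_i], where [m_ij] is the order of [s_i s_j]. The presentation
   is the universal property; uniqueness of [phi] follows from
   [cox_gen]. A pair with
   [m i j = 0] (infinite order) imposes no relation, as [x ^+ 0 = 1]. A
   [{multiplicative W -> H}] between groups is a group homomorphism. *)
Record coxeter_system (W : groupType) (n : nat) (s : 'I_n -> W)
    (m : 'M[nat]_n) : Prop := CoxeterSystem {
  cox_inj : injective s;
  cox_invol : forall i, has_order (s i) 2;
  cox_order : forall i j, has_order (s i * s j) (m i j);
  cox_gen : generated (range s) = [set: W];
  cox_pres : forall (H : groupType) (f : 'I_n -> H),
    (forall i j, (f i * f j) ^+ m i j = 1) ->
    exists phi : {multiplicative W -> H}, forall i, phi (s i) = f i }.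

Definition crystallographic (n : nat) (m : 'M[nat]_n) : Prop :=
  forall i j, i != j -> m i j \in [:: 2; 3; 4; 6; 0 (* infinity *)].

Definition parabolic (W : groupType) (S P : set W) : Prop :=
  exists (w : W) (J : set W), J `<=` S /\ P = conj_set w (generated J).

Definition inner_by_graph (W : groupType) (S : set W) (alpha : W -> W) : Prop :=
  exists w : W, alpha @` S = conj_set w S.

(* Main.v *)
Require Import Defs.
From HB Require Import structures.
From mathcomp Require Import all_boot all_order all_algebra.
From mathcomp Require Import boolp classical_sets.
From mathcomp Require Import ring lra zify.
From mathcomp Require Import realalg.

Set Implicit Arguments.
Unset Strict Implicit.
Unset Printing Implicit Defensive.
Import Order.TTheory GRing.Theory Num.Theory.
Local Open Scope ring_scope.

(** An inner-by-graph automorphism plainly preserves parabolic subgroups.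
    For the converse, write [r_i = alpha (s_i)].  The claim is that for every
    set [K] of indices the reflections [r_i], [i] in [K], are brought into the
    set of simple reflections by a single conjugation; it is proved by adding
    the elements of [K] one at a time ([normal_form], [extend]).

    Everything takes place in geometric representations.  A generalised Cartan
    matrix [A] with [A i j * A j i = 4 cos^2 (pi / m i j)] (that is, 4 when
    [m i j] is infinite) gives a representation of [W] by reflections
    whose roots are sign-coherent: this is Tits' theorem, proved here for
    arbitrary families of reflections generating a group ([tits_cone]).  Two
    matrices are used: an integral one, where crystallographicity enters, and
    the symmetric one, which carries an invariant form.

    Suppose that the [r_i] with [i] in [K] are already simple, and add an index
    [i0].  Since [alpha] maps parabolic subgroups to parabolic subgroups, the
    [r_i] with [i] in [K] together with [r = r_i0] generate, after conjugation,
    a standard parabolic subgroup [W_J].  In it [r] is conjugate, by an element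
    [u] of the subgroup generated by the [r_i], to the one simple reflection
    [s0] missing from [K] ([new_reflection]): a conjugate of [r] of minimal
    length has nonpositive pairings with the simple roots of [K]; in the
    integral representation these are integers, so Tits' theorem applies to the
    simple roots of [K] together with the root of this conjugate, and the latter
    must be the missing simple root.

    It remains to choose [u] well.  The pairings of the root of [r] with the
    simple roots of [K] are, up to sign, those prescribed by the Coxeter matrix,
    because all pairs of the [r_i] are conjugate to pairs of simple
    reflections.  Signs must not be mixed inside a connected component of [K].
    For this one compares two weights for [W_K], the one of [r] and the one of
    [s_i0].  They agree up to signs; so do their images under [u], which are
    the weight of [s0] and the one of the preimage of [s0] under [alpha]: here
    the inverse of [alpha] must preserve parabolic subgroups as well, which
    follows by the pigeonhole principle ([preserves_parabolics_inv]).  The sum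
    of the two weights and the image of this sum are both antidominant, hence
    the sum is fixed by [u] ([antidominant_stab]); the difference is dominant
    and has antidominant image.  A root of [W_K] pairing nontrivially with both
    would contradict sign-coherence ([pairing_sign]).

    On the union [L] of the components where the pairings are nonnegative and
    not all zero, [W_L] turns out to be finite: only finitely many roots pair
    positively with the given dominant weight, and connectedness propagates
    this finiteness to all roots of [W_L] ([finite_above_step]).  Conjugation by
    its longest element permutes the simple reflections of [K] and makes all
    pairings nonpositive, and then the new reflection is simple as well. *)

(** * Words and lengths *)

Section Words.
Local Open Scope group_scope.
Variables (G : groupType) (T : Type) (g : T -> G).

Definition wprod (w : seq T) : G := foldr (fun i x => g i * x) 1 w.

Lemma wprod_cat w1 w2 : wprod (w1 ++ w2) = wprod w1 * wprod w2.
Proof. by elim: w1 => [|i w IH] /=; rewrite ?mul1g // IH mulgA. Qed.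

Lemma wprod_rcons w i : wprod (rcons w i) = wprod w * g i.
Proof. by rewrite -cats1 wprod_cat /= mulg1. Qed.

Definition len_spec x k := exists2 w, size w = k & wprod w = x.

Definition len (x : G) : nat :=
  match pselect (exists k, `[< len_spec x k >]) with
  | left h => ex_minn h
  | right _ => 0%N
  end.

Lemma len_le w : (len (wprod w) <= size w)%N.
Proof.
rewrite /len; case: pselect => [h|//].
by case: ex_minnP => k _; apply; apply/asboolP; exists w.
Qed.

Lemma len_word w : exists2 w', wprod w' = wprod w & size w' = len (wprod w).
Proof.
rewrite /len; case: pselect => [h|[]]; last first.
  by exists (size w); apply/asboolP; exists w.
by case: ex_minnP => k /asboolP[w' <- <-] _; exists w'.
Qed.

Definition gen x := exists w, wprod w = x.

Lemma gen_mul x y : gen x -> gen y -> gen (x * y).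
Proof. by move=> [w <-] [w' <-]; exists (w ++ w'); rewrite wprod_cat. Qed.

Lemma gen_g i : gen (g i).
Proof. by exists [:: i]; rewrite /= mulg1. Qed.

Lemma len_mul x y : gen x -> gen y -> (len (x * y) <= len x + len y)%N.
Proof.
move=> [w <-] [w' <-].
have [v <- <-] := len_word w; have [v' <- <-] := len_word w'.
by rewrite -wprod_cat -size_cat len_le.
Qed.

Lemma len_g i : (len (g i) <= 1)%N.
Proof. by have := len_le [:: i]; rewrite /= mulg1. Qed.

Lemma len_mulg x i : gen x -> (len (x * g i) <= (len x).+1)%N.
Proof.
by move=> hx; rewrite -addn1 (leq_trans (len_mul _ _)) ?leq_add2l ?len_g //;
  exact: gen_g.
Qed.

End Words.

Lemma gen_descent (G : groupType) (T : Type) (g : T -> G) x :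
  (forall i, g i * g i = 1)%g -> gen g x -> x <> 1%g ->
  exists i, (len g (x * g i)%g < len g x)%N.
Proof.
move=> gK [w wx] x1; have [w' xw sw] := len_word g w; rewrite {}wx in xw sw.
case: (lastP w') xw sw => [/esym //|{}w' i] xw sw; exists i.
rewrite -sw size_rcons ltnS -xw wprod_rcons -mulgA gK mulg1.
exact: len_le.
Qed.

(** * Tits' theorem for groups generated by reflections *)

Section Tits.
Variables (R : realFieldType) (V : lmodType R) (G : groupType) (T : eqType).
Variables (g : T -> G) (act : G -> V -> V) (b : T -> V) (c : T -> T -> R).
Hypothesis act1 : forall v, act 1%g v = v.
Hypothesis actM : forall x y v, act (x * y)%g v = act x (act y v).
Hypothesis actD : forall x u v, act x (u + v) = act x u + act x v.
Hypothesis actZ : forall x a v, act x (a *: v) = a *: act x v.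
Hypothesis gK : forall i, (g i * g i = 1)%g.
Hypothesis act_diag : forall i, act (g i) (b i) = - b i.
Hypothesis act_off : forall i j, i != j -> act (g i) (b j) = b j + c i j *: b i.

(** Off the diagonal, [- c i j] are the entries of a Cartan matrix.  The product
    [c i j * c j i] is [4 cos^2 (pi / m)] for [m] = 2, 3, 4, 6, with the
    corresponding relation in the group; from 4 on, the two reflections generate
    an infinite dihedral group. *)
Definition dihedral_ok i j : Prop :=
  4 <= c i j * c j i \/
  [/\ c i j = 0, c j i = 0 & ((g i * g j) ^+ 2 = 1)%g] \/
  exists m e : nat, [/\ (m, e) \in [:: (3, 1); (4, 2); (6, 3)]%N,
    c i j * c j i = e%:R & ((g i * g j) ^+ m = 1)%g].

Hypothesis c_ge0 : forall i j, i != j -> 0 <= c i j.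
Hypothesis c_ok : forall i j, i != j -> dihedral_ok i j.

Section Cone.
Variable C : V -> Prop.
Hypothesis Cb : forall i, C (b i).
Hypothesis CD : forall u v, C u -> C v -> C (u + v).
Hypothesis CZ : forall a v, 0 <= a -> C v -> C (a *: v).

(** The alternating product of [L] factors [g s] and [g t] whose last factor is
    [g t], whatever the parity of [L]. *)
Fixpoint alt (s t : T) (L : nat) : G :=
  match L with
  | 0 => 1%g
  | L'.+1 => (g (if odd L' then s else t) * alt s t L')%g
  end.

Lemma altSr s t L : (alt s t L.+1 = alt t s L * g t)%g.
Proof.
elim: L => [|L IH]; first by rewrite /= mul1g mulg1.
rewrite -[LHS]/(g (if odd L.+1 then s else t) * alt s t L.+1)%g IH mulgA /=.
by case: (odd L).
Qed.

Lemma braid s t m : (m \in [:: 2; 3; 4; 6])%N ->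
  ((g s * g t) ^+ m = 1 -> alt s t m = alt t s m)%g.
Proof.
have gi i : ((g i)^-1 = g i)%g by apply: mulg1_eq.
have iK : ((g s * g t)^-1 = g t * g s)%g by rewrite invgM !gi.
have ev k : ((g s * g t) ^+ (k + k) = 1 ->
             (g s * g t) ^+ k = (g t * g s) ^+ k)%g.
  by rewrite expgnDr => /mulg1_eq; rewrite -iK expVgn => {2}<-; rewrite invgK.
rewrite !inE => /or4P[]/eqP-> h /=; rewrite ?mulg1.
- by have := ev 1%N h; rewrite !expg1.
- have h2 : ((g s * g t) ^+ 2 = g t * g s)%g.
    by rewrite -iK; apply/esym/mulg1_eq; rewrite -expgS.
  have: ((g s * g t) ^+ 2 * g t = g t * g s * g t)%g by rewrite h2.
  by rewrite expg2 -!mulgA gK mulg1 => <-.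
- by have := ev 2%N h; rewrite !expg2 -!mulgA.
- by have := ev 3%N h; rewrite !expgS expg0 !mulg1 -!mulgA.
Qed.

Lemma alt_split s t k m : exists2 w, size w = k &
  (alt s t (k + m) = wprod g w * alt s t m)%g.
Proof.
elim: k => [|k [w sw IH]]; first by exists [::]; rewrite ?mul1g.
exists ((if odd (k + m) then s else t) :: w) => /=; first by rewrite sw.
by rewrite IH mulgA.
Qed.

Lemma gen_alt s t L : gen g (alt s t L).
Proof.
by have [u _] := alt_split s t L 0; rewrite addn0 mulg1 => ->; exists u.
Qed.

Lemma len_alt s t L : (len g (alt s t L) <= L)%N.
Proof.
have [u su] := alt_split s t L 0; rewrite addn0 mulg1 => ->.
by rewrite -[leqRHS]su len_le.
Qed.

(** Coordinates of [alt s t L] applied to [b s] in the basis [b s], [b t]. *)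
Fixpoint alt_coef (p q : R) (L : nat) : R * R :=
  match L with
  | 0 => (1, 0)
  | L'.+1 => let xy := alt_coef p q L' in
    if odd L' then (q * xy.2 - xy.1, xy.2) else (xy.1, p * xy.1 - xy.2)
  end.

Lemma act_alt s t L : s != t ->
  act (alt s t L) (b s) =
  (alt_coef (c t s) (c s t) L).1 *: b s + (alt_coef (c t s) (c s t) L).2 *: b t.
Proof.
move=> st; elim: L => [|L IH] /=; first by rewrite act1 scale1r scale0r addr0.
rewrite actM IH; set x := (alt_coef _ _ _).1; set y := (alt_coef _ _ _).2.
have ts : t != s by rewrite eq_sym.
case: (odd L) => /=; rewrite actD !actZ act_diag act_off //.
  by rewrite scalerDr scalerBl scalerN scalerA [y * _]mulrC addrC -addrA addrC.
by rewrite scalerDr scalerBl scalerN scalerA [x * _]mulrC addrA.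
Qed.

(** The last clause, the induction invariant, says that the coordinate changed
    by the next reflection does not decrease. *)
Lemma alt_coef_inf p q L : 0 <= p -> 0 <= q -> 4 <= p * q ->
  let x := (alt_coef p q L).1 in let y := (alt_coef p q L).2 in
  [/\ 0 <= x, 0 <= y & if odd L then 2 * x <= q * y else 2 * y <= p * x].
Proof.
move=> p0 q0 pq; elim: L => [|L] /=; first by split=> //; nra.
case: (alt_coef p q L) => x y /=; case: (odd L) => /= -[x0 y0 h].
  split=> //; first by lra.
  have: 0 <= (p * q - 4) * y by apply: mulr_ge0 => //; lra.
  have: 0 <= p * (q * y - 2 * x) by apply: mulr_ge0 => //; lra.
  by nra.
split=> //; first by lra.
have: 0 <= (p * q - 4) * x by apply: mulr_ge0 => //; lra.
have: 0 <= q * (p * x - 2 * y) by apply: mulr_ge0 => //; lra.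
by nra.
Qed.

Lemma alt_coefE p q (d := p * q) :
  [/\ alt_coef p q 2 = (d - 1, p), alt_coef p q 3 = (d - 1, p * (d - 2)),
      alt_coef p q 4 = (d ^+ 2 - 3 * d + 1, p * (d - 2)) &
      alt_coef p q 5 = (d ^+ 2 - 3 * d + 1, p * (d ^+ 2 - 4 * d + 3))].
Proof. by split; rewrite /d /=; congr (_, _); ring. Qed.

(** Below the order of the product of two reflections an alternating product
    stays on the positive side of the simple roots of the dihedral group. *)
Lemma alt_coef_fin p q m e L : 0 <= p ->
  (m, e) \in [:: (3, 1); (4, 2); (6, 3)]%N -> p * q = e%:R -> (L < m)%N ->
  0 <= (alt_coef p q L).1 /\ 0 <= (alt_coef p q L).2.
Proof.
move=> p0; have [E2 E3 E4 E5] := alt_coefE p q.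
rewrite !inE => /or3P[]/eqP[-> ->] pq;
  (do 6?[case: L => [|L] //]) => _;
  rewrite ?E2 ?E3 ?E4 ?E5 ?pq /=; split=> //; try lra; apply: mulr_ge0 => //; lra.
Qed.

(** Only lengths of words matter.  If [x] does not
    get shorter on the right by [g s], write [x = v * a], lengths adding up, with
    [a] the longest possible alternating product of [g s] and another [g t].
    Then [v] gets shorter neither by [g s] nor by [g t], so [act v] keeps both
    [b s] and [b t] in the cone by induction, while [act a (b s)] is a
    nonnegative combination of them because [a] is shorter than the braid
    relation. *)
Theorem tits_cone x i : gen g x -> (len g x <= len g (x * g i)%g)%N ->
  C (act x (b i)).
Proof.
have [k] := ubnP (len g x); elim: k x i => // k IH x s /ltnSE lk gx hs.
have [x1|x1] := eqVneq x 1%g; first by rewrite x1 act1.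
have [w wx sw] : exists2 w, wprod g w = x & size w = len g x.
  by case: gx => w <-; apply: len_word.
case: (lastP w) wx sw => [/= e|{}w t]; first by rewrite -e eqxx in x1.
rewrite wprod_rcons size_rcons => wx sw.
have xt : (x * g t = wprod g w)%g by rewrite -wx -mulgA gK mulg1.
have st : s != t.
  by apply: contraTneq hs => ->; rewrite -ltnNge xt -sw ltnS len_le.
(* the lengths of the alternating suffixes of reduced words for [x] *)
pose P L := `[< exists2 v, gen g v & (x = v * alt s t L /\
                 len g x = (len g v + L)%N)%g >].
have P1 : exists L, P L && (0 < L)%N.
  exists 1%N; rewrite andbT; apply/asboolP; exists (wprod g w); first by exists w.
  rewrite /= mulg1 wx; split=> //; apply/eqP; rewrite eqn_leq addn1.
  rewrite -{1}wx len_mulg /=; last by exists w.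
  by rewrite -sw ltnS len_le.
have Pb L : P L && (0 < L)%N -> (L <= len g x)%N.
  by case/andP=> /asboolP[v _ [_ ->]] _; rewrite leq_addl.
case: (ex_maxnP P1 Pb) => -[|L]; rewrite ?andbF // andbT => /asboolP[v gv [xv lv]] maxL.
have lvx : (len g v < len g x)%N by rewrite lv addnS ltnS leq_addr.
pose z := if odd L.+1 then s else t; pose z' := if odd L then s else t.
(* [g z] would prolong the suffix [a], and [g z'] is its first factor *)
have lz : (len g v <= len g (v * g z)%g)%N.
  rewrite leqNgt; apply/negP => lt.
  have gvz : gen g (v * g z)%g by apply: gen_mul => //; apply: gen_g.
  have xvz : (x = v * g z * alt s t L.+2)%g.
    rewrite xv -[alt s t L.+2]/(g z * alt s t L.+1)%g.
    by rewrite -!mulgA (mulgA (g z)) gK mul1g.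
  have: (len g x <= len g (v * g z)%g + L.+2)%N.
    rewrite {1}xvz (leq_trans (len_mul _ _)) ?leq_add2l ?len_alt //.
    exact: gen_alt.
  rewrite lv => le.
  have: P L.+2.
    by apply/asboolP; exists (v * g z)%g => //; split=> //; lia.
  by move=> PL; have := maxL L.+2; rewrite PL /= => /(_ isT); rewrite ltnn.
have lz' : (len g v <= len g (v * g z')%g)%N.
  rewrite leqNgt; apply/negP => lt.
  have gvz : gen g (v * g z')%g by apply: gen_mul => //; apply: gen_g.
  have xvz : (x = v * g z' * alt s t L)%g by rewrite xv /= -/z' mulgA.
  have := len_mul gvz (gen_alt s t L); rewrite -xvz lv.
  by have := len_alt s t L; lia.
have Cz : C (act v (b z)) by apply: IH => //; apply: leq_trans lvx lk.
have Cz' : C (act v (b z')) by apply: IH => //; apply: leq_trans lvx lk.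
have [Cs Ct] : C (act v (b s)) /\ C (act v (b t)).
  by move: Cz Cz'; rewrite /z /z' /=; case: (odd L).
have key : 0 <= (alt_coef (c t s) (c s t) L.+1).1 /\
           0 <= (alt_coef (c t s) (c s t) L.+1).2.
  have p0 : 0 <= c t s by rewrite c_ge0 // eq_sym.
  have q0 : 0 <= c s t by rewrite c_ge0.
  (* a suffix as long as the braid relation could also end in [s] *)
  have short m : (m \in [:: 2; 3; 4; 6])%N -> ((g s * g t) ^+ m = 1)%g ->
      (L.+1 < m)%N.
    move=> mi /(braid mi) e; rewrite ltnNge; apply/negP => le.
    have [m' em] : exists m', m = m'.+1 by case: m mi {e le} => // m'; exists m'.
    have [u su eu] := alt_split s t (L.+1 - m) m; rewrite subnK // in eu.
    have : (x * g s = v * (wprod g u * alt s t m'))%g.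
      by rewrite xv eu e em altSr -!mulgA gK mulg1.
    move: hs => /[swap] ->.
    have gu : gen g (wprod g u) by exists u.
    have := len_mul gv (gen_mul gu (gen_alt s t m')).
    have := len_mul gu (gen_alt s t m'); have := len_le g u.
    have := len_alt s t m'.
    by rewrite lv su em; lia.
  case: (c_ok st) => [inf|[[e1 e2 h]|[m [e [hm hc h]]]]].
  - by have [] := alt_coef_inf L.+1 p0 q0; rewrite 1?mulrC // mulrC.
  - have := short 2%N isT h; case: (L) => // _ /=; rewrite e2 mul0r subr0.
    by split.
  - apply: (alt_coef_fin (m := m) (e := e)) => //; first by rewrite mulrC.
    apply: short => //.
    by move: hm; rewrite !inE => /or3P[]/eqP[-> _].
rewrite xv actM act_alt // actD !actZ.
by case: key => k1 k2; apply: CD; apply: CZ.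
Qed.

End Cone.
End Tits.

(** * Matrices of reflections *)

Section TwoReflections.
Variables (R : realFieldType) (n : nat) (x y : 'M[R]_n).
Let t : 'M[R]_n := (1 - x) * (1 - y).

Let sZl a (u v : 'M[R]_n) : (a *: u) * v = a *: (u * v).
Proof. exact/esym/scalemxAl. Qed.
Let sZr a (u v : 'M[R]_n) : u * (a *: v) = a *: (u * v).
Proof. exact/esym/scalemxAr. Qed.

(** With [x] and [y] of rank one, [t] is the product of two reflections: it is
    the identity modulo the plane of their roots, and has trace [e - 2] and
    determinant 1 on that plane. *)
Lemma reflections_quadratic (e : R) :
  x * x = 2 *: x -> y * y = 2 *: y -> x * y * x = e *: x ->
  y * x * y = e *: y ->
  t * t * (t - 1) - (e - 2) *: (t * (t - 1)) + (t - 1) = 0.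
Proof.
move=> xx yy xyx yxy.
have tE : t - 1 = x * y - x - y.
  rewrite /t mulrBl mul1r mulrBr mulr1 opprB.
  by move: (x * y) => z; apply/matrixP => i j; rewrite !mxE; ring.
have xxy : x * (x * y) = 2 *: (x * y) by rewrite mulrA xx sZl.
have txy : t * (x * y) = (e - 1) *: (x * y) - e *: y.
  have h : (1 - y) * (x * y) = x * y - e *: y by rewrite mulrBl mul1r mulrA yxy.
  rewrite /t -mulrA h mulrBl mul1r mulrBr sZr xxy.
  by move: (x * y) => z; apply/matrixP => i j; rewrite !mxE; ring.
have tx : t * x = (e - 1) *: x - y * x.
  have h : (1 - y) * x = x - y * x by rewrite mulrBl mul1r.
  rewrite /t -mulrA h mulrBl mul1r mulrBr mulrA xyx xx.
  by move: (y * x) => z; apply/matrixP => i j; rewrite !mxE; ring.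
have ty : t * y = x * y - y.
  have h : (1 - y) * y = - y.
    by rewrite mulrBl mul1r yy; apply/matrixP => i j; rewrite !mxE; ring.
  by rewrite /t -mulrA h mulrN mulrBl mul1r opprB.
have tyx : t * (y * x) = e *: x - y * x.
  by rewrite mulrA ty mulrBl xyx.
have t1 : t * (t - 1) = (e - 2) *: (x * y) - (e - 1) *: x + y * x + (1 - e) *: y.
  rewrite tE !mulrBr txy tx ty.
  move: (x * y) (y * x) => z z'.
  by apply/matrixP => i j; rewrite !mxE; ring.
rewrite -mulrA t1 tE !(mulrDr t) !mulrN !sZr txy tx ty tyx.
move: (x * y) (y * x) => z z'.
by apply/matrixP => i j; rewrite !mxE; ring.
Qed.

(** For [e] = 1, 2, 3 the polynomial [(X - 1) (X^2 - (e - 2) X + 1)] divides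
    [X^m - 1] with [m] = 3, 4, 6. *)
Lemma reflections_order (m e : nat) :
  x * x = 2 *: x -> y * y = 2 *: y -> x * y * x = e%:R *: x ->
  y * x * y = e%:R *: y ->
  (m, e) \in [:: (3, 1); (4, 2); (6, 3)]%N -> t ^+ m = 1.
Proof.
move=> xx yy xyx yxy /[!inE] me.
have := reflections_quadratic xx yy xyx yxy; move: (t) => z.
have zz : z * z * (z - 1) = z ^+ 3 - z ^+ 2.
  by rewrite mulrBr mulr1 -expr2 -exprSr.
have z1 : z * (z - 1) = z ^+ 2 - z by rewrite mulrBr mulr1 expr2.
case/or3P: me => /eqP[-> ->]; rewrite zz z1 => h;
  apply/eqP; rewrite -subr_eq0; apply/eqP.
- rewrite -[RHS]h; move: (z ^+ 3) (z ^+ 2) => a c.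
  by apply/matrixP => i j; rewrite !mxE; ring.
- have h3 : z ^+ 3 = z ^+ 2 - z + 1.
    apply/eqP; rewrite -subr_eq0; apply/eqP; rewrite -[RHS]h.
    by move: (z ^+ 3) (z ^+ 2) => a c; apply/matrixP => i j; rewrite !mxE; ring.
  rewrite exprS h3 mulrDr mulr1 mulrBr -exprS h3 -expr2.
  by move: (z ^+ 2) => c; apply/matrixP => i j; rewrite !mxE; ring.
- have h3 : z ^+ 3 = 2 *: z ^+ 2 - 2 *: z + 1.
    apply/eqP; rewrite -subr_eq0; apply/eqP; rewrite -[RHS]h.
    by move: (z ^+ 3) (z ^+ 2) => a c; apply/matrixP => i j; rewrite !mxE; ring.
  have h4 : z ^+ 4 = 2 *: z ^+ 2 - 3 *: z + (1 + 1).
    rewrite exprS h3 mulrDr mulr1 mulrBr !sZr -exprS h3 -expr2.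
    by move: (z ^+ 2) => c; apply/matrixP => i j; rewrite !mxE; ring.
  have h5 : z ^+ 5 = z ^+ 2 - 2 *: z + (1 + 1).
    rewrite exprS h4 mulrDr mulrBr !sZr mulrDr mulr1 -exprS h3 -expr2.
    by move: (z ^+ 2) => c; apply/matrixP => i j; rewrite !mxE; ring.
  rewrite exprS h5 mulrDr mulrBr !sZr mulrDr mulr1 -exprS h3 -expr2.
  by move: (z ^+ 2) => c; apply/matrixP => i j; rewrite !mxE; ring.
Qed.

(** For [e = 0] the polynomial above has the multiple root -1, so that the
    vanishing of both products [x * y] and [y * x] has to be used. *)
Lemma reflections_commute :
  x * x = 2 *: x -> y * y = 2 *: y -> x * y = 0 -> y * x = 0 -> t ^+ 2 = 1.
Proof.
move=> xx yy xy yx.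
have tE : t = 1 - x - y by rewrite /t mulrBl mul1r mulrBr mulr1 xy subr0 addrAC.
rewrite expr2 tE !mulrBl !mulrBr !mul1r !mulr1 xx yy xy yx.
by apply/matrixP => i j; rewrite !mxE; ring.
Qed.
End TwoReflections.

Section MatrixGroup.
Variables (R : fieldType) (n : nat).

(** The target group of the geometric representations, in all dimensions
    including 0. *)
Record unit_mx := UnitMx { umx : 'M[R]_n; umxP : umx \in unitmx }.
HB.instance Definition _ := [isSub for umx].
HB.instance Definition _ := [Choice of unit_mx by <:].

Definition umx_one := @UnitMx 1%:M (unitmx1 R n).
Fact umx_mul_subproof (A B : unit_mx) : umx A *m umx B \in unitmx.
Proof. by rewrite unitmx_mul !umxP. Qed.
Definition umx_mul A B := UnitMx (umx_mul_subproof A B).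
Fact umx_inv_subproof (A : unit_mx) : invmx (umx A) \in unitmx.
Proof. by rewrite unitmx_inv umxP. Qed.
Definition umx_inv A := UnitMx (umx_inv_subproof A).

Fact umx_mulA : associative umx_mul.
Proof. by move=> A B C; apply: val_inj; rewrite /= mulmxA. Qed.
Fact umx_mul1 : left_id umx_one umx_mul.
Proof. by move=> A; apply: val_inj; rewrite /= mul1mx. Qed.
Fact umx_mulr1 : right_id umx_one umx_mul.
Proof. by move=> A; apply: val_inj; rewrite /= mulmx1. Qed.
Fact umx_mulV : left_inverse umx_one umx_inv umx_mul.
Proof. by move=> A; apply: val_inj; rewrite /= mulVmx ?umxP. Qed.
Fact umx_mulrV : right_inverse umx_one umx_inv umx_mul.
Proof. by move=> A; apply: val_inj; rewrite /= mulmxV ?umxP. Qed.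

HB.instance Definition _ := isGroup.Build unit_mx
  umx_mulA umx_mul1 umx_mulr1 umx_mulV umx_mulrV.

Lemma umxM (A B : unit_mx) : umx (A * B)%g = umx A *m umx B. Proof. by []. Qed.
Lemma umxX (A : unit_mx) k : umx (A ^+ k)%g = umx A ^+ k.
Proof. by elim: k => [|k IH]; rewrite ?expg0 // expgS exprS umxM IH. Qed.
End MatrixGroup.

Lemma has_order_inj (G : groupType) (x : G) d d' :
  has_order x d -> has_order x d' -> d = d'.
Proof.
move=> h h'; apply/eqP; rewrite eqn_dvd; apply/andP; split.
  by apply/h/h'.
by apply/h'/h.
Qed.

Section Reflection.
Variables (R : realFieldType) (n : nat).

Definition refl (b : 'cV[R]_n) (f : 'rV[R]_n) : 'M[R]_n := 1%:M - b *m f.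

Lemma outer_sq (b : 'cV[R]_n) (f : 'rV[R]_n) (b' : 'cV[R]_n) (f' : 'rV[R]_n) :
  (b *m f) * (b' *m f') = (f *m b') 0 0 *: (b *m f').
Proof.
rewrite -[_ * _]/(_ *m _) mulmxA -(mulmxA b) {1}[f *m b']mx11_scalar.
by rewrite mul_mx_scalar scalemxAl.
Qed.

Lemma outer_cube (b : 'cV[R]_n) (f : 'rV[R]_n) (b' : 'cV[R]_n) (f' : 'rV[R]_n) :
  (b *m f) * (b' *m f') * (b *m f) =
  ((f *m b') 0 0 * (f' *m b) 0 0) *: (b *m f).
Proof.
rewrite outer_sq -[_ * _]/(_ *m _) -scalemxAl.
by rewrite -[(b *m f') *m _]/((b *m f') * (b *m f)) outer_sq scalerA.
Qed.

Lemma refl_mul b f (v : 'cV[R]_n) : refl b f *m v = v - (f *m v) 0 0 *: b.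
Proof.
by rewrite /refl mulmxBl mul1mx -mulmxA {1}[f *m v]mx11_scalar mul_mx_scalar.
Qed.

Lemma refl_mulr b f (h : 'rV[R]_n) : h *m refl b f = h - (h *m b) 0 0 *: f.
Proof.
by rewrite /refl mulmxBr mulmx1 mulmxA {1}[h *m b]mx11_scalar mul_scalar_mx.
Qed.

Lemma refl_order b f b' f' (m e : nat) :
  (f *m b) 0 0 = 2 -> (f' *m b') 0 0 = 2 ->
  (f *m b') 0 0 * (f' *m b) 0 0 = e%:R ->
  (m, e) \in [:: (3, 1); (4, 2); (6, 3)]%N ->
  (refl b f *m refl b' f') ^+ m = 1.
Proof.
move=> h2 h2' he me; apply: (reflections_order (e := e)) me.
- by rewrite outer_sq h2.
- by rewrite outer_sq h2'.
- by rewrite outer_cube he.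
- by rewrite outer_cube mulrC he.
Qed.

Lemma refl_order2 b f b' f' :
  (f *m b) 0 0 = 2 -> (f' *m b') 0 0 = 2 ->
  (f *m b') 0 0 = 0 -> (f' *m b) 0 0 = 0 ->
  (refl b f *m refl b' f') ^+ 2 = 1.
Proof.
move=> h2 h2' e e'; apply: reflections_commute.
- by rewrite outer_sq h2.
- by rewrite outer_sq h2'.
- by rewrite outer_sq e scale0r.
- by rewrite outer_sq e' scale0r.
Qed.

Lemma refl_sq b f : (f *m b) 0 0 = 2 -> refl b f *m refl b f = 1%:M.
Proof.
move=> h; rewrite {1}/refl mulmxBl mul1mx -mulmxA refl_mulr h.
rewrite mulmxBr -scalemxAr /refl.
by move: (b *m f) => z; apply/matrixP => i j; rewrite !mxE; ring.
Qed.

Definition posv (v : 'cV[R]_n) := forall k, 0 <= v k 0.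
Definition negv (v : 'cV[R]_n) := forall k, v k 0 <= 0.
End Reflection.

Notation basis i := (delta_mx i 0).

Lemma mul_basis (R : realFieldType) (n p : nat) (M : 'M[R]_(p, n)) i k :
  (M *m (basis i : 'cV[R]_n)) k 0 = M k i.
Proof. by rewrite -colE mxE. Qed.

Lemma basisE (R : realFieldType) (n : nat) (i k : 'I_n) :
  (basis i : 'cV[R]_n) k 0 = (k == i)%:R.
Proof. by rewrite mxE eqxx andbT. Qed.

(** The integer [4 cos^2 (pi / k)] for the crystallographic orders; the value 4
    belongs to the infinite order, encoded by 0. *)
Definition bond (k : nat) : nat :=
  if k == 2 then 0 else if k == 3 then 1 else if k == 4 then 2
  else if k == 6 then 3 else 4.

(** * Coxeter systems and standard subgroups *)

Section Coxeter.
Variables (W : groupType) (n : nat) (s : 'I_n -> W) (m : 'M[nat]_n).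
Hypothesis hW : coxeter_system s m.

Lemma sK i : (s i * s i)%g = 1%g.
Proof. by apply/(cox_invol hW i 2). Qed.

Lemma sV i : ((s i)^-1 = s i)%g.
Proof. by apply: mulg1_eq; apply: sK. Qed.

Lemma cox_sym i j : m i j = m j i.
Proof.
apply: (has_order_inj (cox_order hW i j)) => k.
have -> : (s i * s j = (s j * s i)^-1)%g by rewrite invgM !sV.
rewrite expVgn; have [h1 h2] := cox_order hW j i k; split=> [e|/h2->].
  by apply: h1; rewrite -[LHS]invgK e invg1.
by rewrite invg1.
Qed.

Lemma cox_diag i : m i i = 1%N.
Proof.
apply: (has_order_inj (cox_order hW i i)) => k.
by rewrite sK expg1n dvd1n; split.
Qed.

(** The standard subgroup attached to [K]; see [generatedE]. *)
Definition inW (K : {set 'I_n}) x := exists2 w, all (mem K) w & wprod s w = x.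

Lemma inW1 K : inW K 1%g. Proof. by exists [::]. Qed.
Lemma inWM K x y : inW K x -> inW K y -> inW K (x * y)%g.
Proof.
move=> [w hw <-] [w' hw' <-]; exists (w ++ w'); last exact: wprod_cat.
by rewrite all_cat hw.
Qed.
Lemma inW_s (K : {set 'I_n}) i : i \in K -> inW K (s i).
Proof. by move=> iK; exists [:: i]; rewrite /= ?iK ?mulg1. Qed.
Lemma wprodV w : ((wprod s w)^-1 = wprod s (rev w))%g.
Proof.
by elim: w => [|i w IH] /=; rewrite ?invg1 // rev_cons wprod_rcons invgM IH sV.
Qed.
Lemma inWV K x : inW K x -> inW K x^-1%g.
Proof. by case=> w hw <-; exists (rev w); rewrite ?all_rev // wprodV. Qed.

Lemma inW_sub (K L : {set 'I_n}) x : K \subset L -> inW K x -> inW L x.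
Proof.
move=> KL [w hw <-]; exists w => //.
by apply: sub_all hw => i /= iK; exact: (fintype.subsetP KL).
Qed.

Lemma generatedE (K : {set 'I_n}) :
  generated [set s i | i in [set j | j \in K]]%classic = [set x | inW K x]%classic.
Proof.
apply/seteqP; split=> [x|x [w hw <-]].
  apply; split.
    split=> [|y z|y]; [exact: inW1|exact: inWM|exact: inWV].
  by move=> _ [i iK <-]; apply: inW_s.
move=> B [[B1 BM BV] sB].
elim: w hw => [|i w IH] //= /andP[iK hw]; apply: BM; last exact: IH.
by apply: sB; exists i.
Qed.

Lemma all_gen x : gen s x.
Proof.
have : generated (range s) x by rewrite (cox_gen hW).
apply; split.
  split=> [|y z|y [w <-]]; [by exists [::] | exact: gen_mul |].
  by exists (rev w); rewrite wprodV.
by move=> _ [i _ <-]; apply: gen_g.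
Qed.

Local Notation len := (len s).

Lemma lenV x : len x^-1%g = len x.
Proof.
have le y : (len y^-1%g <= len y)%N.
  have [w <-] := all_gen y; have [w' <- <-] := len_word s w.
  by rewrite wprodV -size_rev len_le.
by apply/eqP; rewrite eqn_leq le -{1}[x]invgK le.
Qed.

(** * Generalised Cartan matrices and geometric representations *)

(** The entry [A i k] is the value of the coroot of [s i] on the simple root of
    [s k]. *)
Record gcm (R : realFieldType) (A : 'M[R]_n) : Prop := GCM {
  gcm_diag : forall i, A i i = 2;
  gcm_le0 : forall i j, i != j -> A i j <= 0;
  gcm_bond : forall i j, i != j -> A i j * A j i = (bond (m i j))%:R;
  gcm_zero : forall i j, i != j -> m i j = 2 -> A i j = 0 }.

Lemma gcm_tr (R : realFieldType) (A : 'M[R]_n) : gcm A -> gcm A^T.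
Proof.
move=> [h1 h2 h3 h4]; split=> [i|i j ij|i j ij|i j ij mij]; rewrite !mxE //.
- by rewrite h2 // eq_sym.
- by rewrite h3 1?eq_sym // cox_sym.
- by rewrite h4 1?eq_sym // cox_sym.
Qed.

(** Simple roots are the standard basis vectors, and coroots the rows of [A]. *)
Record representation (R : realFieldType) (A : 'M[R]_n) (rho : W -> 'M[R]_n) :=
  Representation {
  repM : forall x y, rho (x * y)%g = rho x *m rho y;
  repS : forall i, rho (s i) = refl (basis i) (row i A) }.

Hypothesis hm : crystallographic m.

Lemma representation_exists (R : realFieldType) (A : 'M[R]_n) : gcm A ->
  exists rho, representation A rho.
Proof.
move=> gA.
have diag i : (row i A *m (basis i : 'cV_n)) 0 0 = 2.
  by rewrite mul_basis mxE gcm_diag.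
have uP i : refl (basis i) (row i A) \in unitmx.
  by have /mulmx1_unit[] := refl_sq (diag i).
pose f i := UnitMx (uP i).
have [phi phiE] : exists phi : {multiplicative W -> unit_mx R n},
    forall i, phi (s i) = f i.
  apply: (cox_pres hW) => i j; apply: val_inj => /=.
  rewrite umxX umxM /=.
  have [->|ij] := eqVneq i j.
    by rewrite cox_diag expr1 refl_sq.
  have bij : (row i A *m (basis j : 'cV_n)) 0 0 = A i j by rewrite mul_basis mxE.
  have bji : (row j A *m (basis i : 'cV_n)) 0 0 = A j i by rewrite mul_basis mxE.
  have := hm ij; rewrite !inE => mij.
  have hb := gcm_bond gA ij.
  have [m2|m2] := eqVneq (m i j) 2.
    rewrite m2; apply: refl_order2; rewrite ?diag // ?bij ?bji gcm_zero //.
      by rewrite eq_sym.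
    by rewrite cox_sym.
  have [->|m0] := eqVneq (m i j) 0; first by rewrite expr0.
  apply: (refl_order (e := bond (m i j))); rewrite ?diag // ?bij ?bji //.
  case/or4P: mij m2 m0 => [/eqP->|/eqP->|/eqP->|/orP[/eqP->|/eqP->]] //.
exists (fun x => umx (phi x)); split=> [x y|i]; last by rewrite phiE.
by rewrite gmulfM.
Qed.

Section Rep.
Variables (R : realFieldType) (A : 'M[R]_n) (gA : gcm A).
Variables (rho : W -> 'M[R]_n) (hr : representation A rho).
Implicit Types (x y : W) (i j k t : 'I_n) (K : {set 'I_n}).

Let e i : 'cV[R]_n := basis i.
Definition rootv x i : 'cV[R]_n := rho x *m basis i.

Lemma rep_s_mul i v : rho (s i) *m v = v - (A *m v) i 0 *: e i.
Proof. by rewrite (repS hr) refl_mul -row_mul mxE. Qed.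

Lemma rep_s_entry i (v : 'cV[R]_n) k :
  (rho (s i) *m v) k 0 = v k 0 - (A *m v) i 0 * (k == i)%:R.
Proof.
rewrite rep_s_mul; move: (A *m v) => u.
by rewrite !mxE eqxx andbT.
Qed.

Lemma rho1 : rho 1%g = 1%:M.
Proof.
have h : rho 1%g *m rho 1%g = rho 1%g by rewrite -(repM hr) mulg1.
have [->|[x xn]] : rho 1%g = 1%:M \/ exists i : 'I_n, True.
- case: n rho h => [|n'] r _; last by right; exists 0.
  by left; apply/matrixP => -[].
- by [].
have si := refl_sq (b := basis x) (f := row x A).
rewrite mul_basis mxE (gcm_diag gA) // in si; have {}si := si erefl.
rewrite -(repS hr) -(repM hr) sK in si.
exact: si.
Qed.

Lemma rhoVK x : rho x^-1%g *m rho x = 1%:M.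
Proof. by rewrite -(repM hr) mulVg rho1. Qed.
Lemma rhoKV x : rho x *m rho x^-1%g = 1%:M.
Proof. by rewrite -(repM hr) mulgV rho1. Qed.

Lemma rootvM x y i : rootv (x * y)%g i = rho x *m rootv y i.
Proof. by rewrite /rootv (repM hr) mulmxA. Qed.
Lemma rootv1 i : rootv 1%g i = e i. Proof. by rewrite /rootv rho1 mul1mx. Qed.
Lemma root_s x i : rootv (x * s i)%g i = - rootv x i.
Proof.
rewrite rootvM /rootv rep_s_mul mul_basis (gcm_diag gA) //.
rewrite mulmxBr -scalemxAr.
by apply/matrixP => k l; rewrite !mxE; ring.
Qed.
Lemma rep_s_basis i : rho (s i) *m basis i = - basis i :> 'cV[R]_n.
Proof. by have := root_s 1%g i; rewrite mul1g rootv1. Qed.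
Lemma root_entry x i k : rootv x i k 0 = rho x k i.
Proof. exact: mul_basis. Qed.

Lemma root_neq0 x i : rootv x i != 0.
Proof.
apply/eqP => /(congr1 (mulmx (rho x^-1%g))).
rewrite mulmxA rhoVK mul1mx mulmx0 => /matrixP/(_ i 0).
by rewrite basisE eqxx mxE => /eqP; rewrite oner_eq0.
Qed.

Lemma posv_negv (v : 'cV[R]_n) : posv v -> negv v -> v = 0.
Proof.
move=> p q; apply/matrixP => k l; rewrite [l]ord1 mxE.
by apply/eqP; rewrite eq_le p q.
Qed.

Lemma dihedral_simple j k : j != k -> dihedral_ok s (fun i j => - A i j) j k.
Proof.
move=> jk; rewrite /dihedral_ok mulrNN (gcm_bond gA) //.
have := hm jk; rewrite !inE => mjk.
have o := cox_order hW j k.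
have om : ((s j * s k) ^+ m j k = 1)%g by apply/o.
case/or4P: mjk om => [/eqP mjk|/eqP mjk|/eqP mjk|/orP[/eqP mjk|/eqP mjk]];
  rewrite mjk => om.
+ right; left; rewrite !(gcm_zero gA) ?oppr0 //; first by rewrite eq_sym.
  by rewrite cox_sym.
+ by right; right; exists 3, 1.
+ by right; right; exists 4, 2.
+ by right; right; exists 6, 3.
+ by left.
Qed.

(** Sign-coherence of roots: the cone of [tits_cone] is the positive orthant. *)
Lemma root_pos x i : (len x <= len (x * s i)%g)%N -> posv (rootv x i).
Proof.
pose c i j := - A i j.
move=> hx; apply: (@tits_cone R _ W _ s (fun x v => rho x *m v) e c _ _ _ _ _ _ _
  _ _ (@posv R n) _ _ _ x i (all_gen x) hx).
- by move=> v; rewrite rho1 mul1mx.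
- by move=> y z v; rewrite (repM hr) mulmxA.
- by move=> y u v; rewrite mulmxDr.
- by move=> y a v; rewrite scalemxAr.
- exact: sK.
- by move=> j; have := root_s 1%g j; rewrite mul1g rootv1.
- by move=> j k jk; rewrite rep_s_mul mul_basis /c scaleNr.
- by move=> j k jk; rewrite oppr_ge0 (gcm_le0 gA).
- by move=> j k jk; apply: dihedral_simple.
- by move=> j k; rewrite basisE ler0n.
- by move=> u v hu hv k; rewrite mxE addr_ge0.
- by move=> a v ha hv k; rewrite mxE mulr_ge0.
Qed.

Lemma root_neg x i : (len (x * s i)%g < len x)%N -> negv (rootv x i).
Proof.
move=> lt k; have := @root_pos (x * s i)%g i.
rewrite -mulgA sK mulg1 => /(_ (ltnW lt) k).
by rewrite root_s mxE oppr_ge0.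
Qed.

Lemma root_sign x i : posv (rootv x i) \/ negv (rootv x i).
Proof.
by case: (leqP (len x) (len (x * s i)%g)) => [/root_pos|/root_neg]; [left|right].
Qed.

Lemma root_neg_len x i : negv (rootv x i) -> (len (x * s i)%g < len x)%N.
Proof.
move=> h; rewrite ltnNge; apply/negP => /root_pos p.
by have := root_neq0 x i; rewrite (posv_negv p h) eqxx.
Qed.

Lemma root_pos_len x i : posv (rootv x i) -> (len x <= len (x * s i)%g)%N.
Proof.
move=> h; rewrite leqNgt; apply/negP => /root_neg p.
by have := root_neq0 x i; rewrite (posv_negv h p) eqxx.
Qed.

Lemma root_coef_pos x i k : 0 < rootv x i k 0 -> posv (rootv x i).
Proof. by case: (root_sign x i) => // /(_ k) h /lt_geF; rewrite h. Qed.

Lemma root_coef_neg x i k : rootv x i k 0 < 0 -> negv (rootv x i).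
Proof. by case: (root_sign x i) => // /(_ k) h /lt_geF; rewrite h. Qed.

(** The last letter of a reduced word for [x] is a simple root that [x] makes
    negative, unless the word is empty. *)
Lemma roots_pos_eq1 x : (forall i, posv (rootv x i)) -> x = 1%g.
Proof.
move=> h; have [w wx] := all_gen x; have [w' xw sw] := len_word s w.
rewrite {}wx in xw sw.
case: (lastP w') xw sw => [<- //|{}w' i] xw sw.
have := root_pos_len (h i); rewrite -sw size_rcons.
have -> : (x * s i = wprod s w')%g.
  by rewrite -xw wprod_rcons -mulgA sK mulg1.
by rewrite leqNgt ltnS len_le.
Qed.

Lemma rho_faithful x : rho x = 1%:M -> x = 1%g.
Proof.
move=> h; apply: roots_pos_eq1 => i k.
by rewrite root_entry h mxE ler0n.
Qed.

Lemma rho_inj : injective rho.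
Proof.
move=> x y h; apply: divg1_eq; apply: rho_faithful.
by rewrite (repM hr) h rhoKV.
Qed.

Lemma inW_supp K x (v : 'cV[R]_n) k : inW K x -> k \notin K -> (rho x *m v) k 0 = v k 0.
Proof.
case=> w hw <- kK; elim: w v hw => [|i w IH] v /=; first by rewrite rho1 mul1mx.
case/andP=> iK hw; rewrite (repM hr) -mulmxA rep_s_entry IH //.
have -> : (k == i) = false by apply: contraNF kK => /eqP->.
by rewrite mulr0 subr0.
Qed.

Lemma root_supp K x i k : inW K x -> i \in K -> k \notin K -> rootv x i k 0 = 0.
Proof.
move=> hx iK kK; rewrite /rootv (inW_supp _ hx) // basisE.
by case: eqP kK => // ->; rewrite iK.
Qed.

Lemma inW_notin K k : inW K (s k) -> k \in K.
Proof.
move=> h; apply/negP => /negP kK.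
have := inW_supp (basis k) h kK; rewrite rep_s_entry mul_basis basisE eqxx (gcm_diag gA).
by rewrite /= => h1; lra.
Qed.

(** A simple root outside [K] stays positive under [W_K], since its own
    coordinate does not change. *)
Lemma inW_eq1 K x : inW K x -> (forall i, i \in K -> posv (rootv x i)) -> x = 1%g.
Proof.
move=> hx h; apply: roots_pos_eq1 => i.
have [/h //|iK] := boolP (i \in K).
apply: (@root_coef_pos _ _ i).
by rewrite /rootv (inW_supp _ hx) // basisE eqxx ltr01.
Qed.

Lemma inW_descent K x : inW K x -> x <> 1%g ->
  exists2 i, i \in K & negv (rootv x i).
Proof.
move=> hx x1; apply: contrapT => h; apply: x1; apply: (inW_eq1 hx) => i iK.
by case: (root_sign x i) => // hn; case: h; exists i.
Qed.

(** * Reflections and their roots *)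

Lemma rho_conj x i :
  rho (x * s i * x^-1)%g = refl (rootv x i) (row i A *m rho x^-1%g).
Proof.
rewrite !(repM hr) (repS hr) /refl mulmxBr mulmxBl mulmx1 rhoKV.
by rewrite /rootv !mulmxA.
Qed.

Lemma rho_conj_mul x i (v : 'cV[R]_n) :
  rho (x * s i * x^-1)%g *m v =
  v - (row i A *m rho x^-1%g *m v) 0 0 *: rootv x i.
Proof. by rewrite rho_conj refl_mul. Qed.

Lemma conj_root x i : rho (x * s i * x^-1)%g *m rootv x i = - rootv x i.
Proof.
rewrite rho_conj_mul /rootv -mulmxA (mulmxA (rho x^-1%g)) rhoVK mul1mx.
rewrite mul_basis mxE (gcm_diag gA) //.
by apply/matrixP => k l; rewrite !mxE; ring.
Qed.

(** The product of the two reflections is unipotent and moves every vector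
    along [basis k]; hence it keeps all simple roots positive. *)
Lemma conj_eq_simple x t k (c : R) :
  rootv x t = c *: e k -> (x * s t * x^-1)%g = s k.
Proof.
move=> h; have c0 : c != 0.
  by apply: contraNneq (root_neq0 x t) => c0; rewrite h c0 scale0r.
suff: (s k * (x * s t * x^-1))%g = 1%g.
  by move=> /mulg1_eq; rewrite sV.
apply: roots_pos_eq1 => i; rewrite /rootv (repM hr) -mulmxA.
have [->|ik] := eqVneq i k.
  have -> : (basis k : 'cV_n) = c^-1 *: rootv x t.
    by rewrite h scalerA mulVf // scale1r.
  rewrite -scalemxAr conj_root -scalemxAr h mulmxN -scalemxAr rep_s_basis.
  rewrite [c *: - _]scalerN opprK scalerA mulVf // scale1r => l.
  by rewrite basisE ler0n.
move: (@root_coef_pos (s k * (x * s t * x^-1))%g i i).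
rewrite /rootv (repM hr) -mulmxA rho_conj_mul h; apply.
rewrite rep_s_entry (negPf ik) mulr0 subr0.
move: (_ 0 0) => a; rewrite !mxE eqxx (negPf ik) /= !mulr0 subr0.
exact: ltr01.
Qed.

(** The root spans the eigenspace of the reflection for the eigenvalue -1. *)
Lemma root_conj x t y k :
  (x * s t * x^-1 = y * s k * y^-1)%g -> exists c : R, rootv x t = c *: rootv y k.
Proof.
move=> h; have := conj_root x t; rewrite h rho_conj_mul.
set a := (_ 0 0) => /eqP; rewrite -subr_eq0 opprK => /eqP e0.
exists (a / 2); apply/matrixP => i l.
have := congr1 (fun M : 'cV_n => M i l) e0; rewrite !mxE.
move: (rootv x t i l) (rootv y k i l) => u v hu.
by lra.
Qed.

(** Simple roots span extremal rays of the positive orthant. *)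
Lemma basis_extremal (K : {set 'I_n}) (t : 'I_n) (c : 'I_n -> R) (u : 'I_n -> 'cV[R]_n) :
  e t = \sum_(k in K) c k *: u k -> (forall k, k \in K -> posv (c k *: u k)) ->
  exists2 k, k \in K & c k != 0 /\ exists d, u k = d *: e t.
Proof.
move=> et h.
have [k kK ck] : exists2 k, k \in K & c k *: u k != 0.
  apply: contrapT => no; have := root_neq0 1%g t; rewrite rootv1 et big1 ?eqxx //.
  move=> k kK; apply/eqP; apply: contrapT => /negP ck; apply: no; exists k => //.
exists k => //; have c0 : c k != 0.
  by apply: contraNneq ck => ->; rewrite scale0r.
split=> //; exists (u k t 0); apply/matrixP => l l'; rewrite [l']ord1 {l'}.
rewrite !mxE !eqxx andbT.
have [->|lt] := eqVneq l t; first by rewrite mulr1.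
have := congr1 (fun M : 'cV_n => M l 0) et; rewrite basisE (negPf lt) summxE.
rewrite (bigD1 k) //= => /esym/eqP; rewrite paddr_eq0.
- by rewrite mxE mulr0 => /andP[]; rewrite mulf_eq0 (negPf c0) => /eqP.
- exact: h.
- by apply: sumr_ge0 => i /andP[iK _]; apply: h.
Qed.

Lemma sum_supp K (v : 'cV[R]_n) : (forall k, k \notin K -> v k 0 = 0) ->
  v = \sum_(k in K) v k 0 *: e k.
Proof.
move=> h; apply/matrixP => i l; rewrite [l]ord1 summxE.
have [iK|iK] := boolP (i \in K).
  rewrite (bigD1 i) //= big1 ?addr0 ?mxE ?eqxx ?mulr1 // => k /andP[_ ki].
  by rewrite !mxE eq_sym (negPf ki) mulr0.
rewrite h // big1 // => k kK; rewrite !mxE.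
by case: eqP iK => [->|]; rewrite ?kK // mulr0.
Qed.

(** If [v] keeps the simple roots of [K] positive, then they remain simple for
    the subgroup [v W_K v^-1]: a simple root lying in the root system of this
    subgroup is a nonnegative combination of positive roots [v * basis j], and
    extremality makes it one of them. *)
Lemma simple_in_conj K v z t : (forall j, j \in K -> posv (rootv v j)) ->
  inW K z -> (s t = v * z * v^-1)%g ->
  exists2 j, j \in K & (s t = v * s j * v^-1)%g.
Proof.
move=> vK hz st.
pose f := rootv v^-1%g t.
have zf : rho z *m f = - f.
  have -> : z = (v^-1 * s t * v)%g by rewrite st !mulgA mulVg mul1g mulgVK.
  rewrite !(repM hr) /f /rootv -!mulmxA (mulmxA (rho v)) rhoKV mul1mx.
  rewrite rep_s_mul mul_basis (gcm_diag gA) // mulmxBr -scalemxAr.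
  by apply/matrixP => i l; rewrite !mxE; ring.
have fK k : k \notin K -> f k 0 = 0.
  move=> kK; have := inW_supp f hz kK; rewrite zf mxE.
  by move/eqP; rewrite -subr_eq0 -opprD oppr_eq0 -mulr2n mulrn_eq0 => /eqP.
have vf : e t = \sum_(j in K) f j 0 *: rootv v j.
  rewrite [LHS](_ : _ = rho v *m f); last by rewrite /f /rootv mulmxA rhoKV mul1mx.
  rewrite {1}(sum_supp fK) mulmx_sumr; apply: eq_bigr => j _.
  by rewrite -scalemxAr.
have fpos : posv f.
  case: (root_sign v^-1%g t) => // fn.
  have := root_neq0 1%g t; rewrite rootv1 (@posv_negv (e t)) ?eqxx // => k.
    by rewrite basisE ler0n.
  rewrite vf summxE sumr_le0 // => j jK; rewrite mxE.
  by apply: mulr_le0_ge0; [apply: fn | apply: vK].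
have [j jK [_ [d hd]]] := basis_extremal vf (fun j jK k =>
  let: h := mulr_ge0 (fpos j) (vK j jK k) in
  eq_ind_r (fun r => 0 <= r) h (mxE _ _ _ _)).
by exists j => //; rewrite (conj_eq_simple hd).
Qed.

Lemma stab_functional K (f : 'rV[R]_n) w : inW [set i in K | f 0 i == 0] w ->
  f *m rho w = f.
Proof.
case=> u hu <-; elim: u hu => [_|j u IHu] /=; first by rewrite rho1 mulmx1.
case/andP; rewrite inE => /andP[jK /eqP fj] hu.
by rewrite (repM hr) mulmxA (repS hr) refl_mulr mul_basis fj scale0r subr0 IHu.
Qed.

(** The antidominant cone is a fundamental domain: an element of [W_K] mapping
    an antidominant functional to an antidominant one fixes it, and lies in the
    subgroup generated by the simple reflections fixing it.  If [s i] is a left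
    descent of [w], the image of [f] is both nonnegative and nonpositive on the
    simple root [basis i], so that [s i * w] maps [f] to the same image. *)
Lemma antidominant_stab K w (f : 'rV[R]_n) : inW K w ->
  (forall i, i \in K -> f 0 i <= 0) ->
  (forall i, i \in K -> (f *m rho w^-1%g) 0 i <= 0) ->
  inW [set i in K | f 0 i == 0] w.
Proof.
have [k] := ubnP (len w); elim: k w => // k IH w /ltnSE lk hw fK.
set h := f *m _ => hK.
have [->|/eqP w1] := eqVneq w 1%g; first exact: inW1.
have [i iK hi] : exists2 i, i \in K & negv (rootv w^-1%g i).
  apply: inW_descent; first exact: inWV.
  by move=> w1'; apply: w1; rewrite -[w]invgK w1' invg1.
have hi0 : h 0 i = 0.
  apply/eqP; rewrite eq_le hK //= -(mul_basis h) /h -mulmxA mxE sumr_ge0 //.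
  move=> j _; have [jK|jK] := boolP (j \in K).
    by apply: mulr_le0; [apply: fK | apply: hi].
  by rewrite -/(rootv w^-1%g i) (@root_supp K) ?mulr0 //; exact: inWV.
have hsi : h *m rho (s i) = h.
  by rewrite (repS hr) refl_mulr mul_basis hi0 scale0r subr0.
have e' : ((s i * w)^-1 = w^-1 * s i)%g by rewrite invgM sV.
have hw' : inW [set i in K | f 0 i == 0] (s i * w)%g.
  apply: IH => //.
  - have := root_neg_len hi; rewrite -e' !lenV => lt; exact: leq_trans lt lk.
  - by apply: inWM => //; apply: inW_s.
  - by move=> j jK; rewrite e' (repM hr) mulmxA -/h hsi; apply: hK.
have hf : h = f.
  by rewrite -hsi /h -mulmxA -(repM hr) -e' (stab_functional (inWV hw')).
have -> : w = (s i * (s i * w))%g by rewrite mulgA sK mul1g.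
apply: inWM => //; apply: inW_s; rewrite inE iK /= -hf hi0 eqxx //.
Qed.

(** Every coset of [W_K] contains an element keeping the simple roots of [K]
    positive, namely one of minimal length. *)
Lemma coset_min K v : exists2 z, inW K z & forall j, j \in K -> posv (rootv (v * z)%g j).
Proof.
pose P (k : nat) := `[< exists2 z, inW K z & len (v * z)%g = k >].
have exP : exists k : nat, P k by exists (len (v * 1)%g); apply/asboolP; exists 1%g => //; exact: inW1.
case: (ex_minnP exP) => k /asboolP[z hz lz] mink; exists z => // j jK.
apply: root_pos; rewrite lz; apply: mink; apply/asboolP.
by exists (z * s j)%g; rewrite ?mulgA //; apply: inWM => //; apply: inW_s.
Qed.

End Rep.
End Coxeter.

(** * A reflection completing a set of simple reflections *)

Definition isint (R : pzRingType) (a : R) := exists z : int, a = z%:~R.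

Section IsInt.
Variable R : realFieldType.
Implicit Types a b : R.
Lemma isintD a b : isint a -> isint b -> isint (a + b).
Proof. by move=> [x ->] [y ->]; exists (x + y); rewrite intrD. Qed.
Lemma isintN a : isint a -> isint (- a).
Proof. by move=> [x ->]; exists (- x); rewrite intrN. Qed.
Lemma isintM a b : isint a -> isint b -> isint (a * b).
Proof. by move=> [x ->] [y ->]; exists (x * y); rewrite intrM. Qed.
Lemma isint_nat k : isint (k%:R : R).
Proof. by exists k%:Z. Qed.
Lemma isint_sum (I : Type) (r : seq I) (P : pred I) (F : I -> R) :
  (forall i, P i -> isint (F i)) -> isint (\sum_(i <- r | P i) F i).
Proof.
move=> h; apply: (big_ind (@isint R)) => //; [exact: (isint_nat 0) | exact: isintD].
Qed.
Lemma isint_mul n p q (M : 'M[R]_(n, p)) (N : 'M[R]_(p, q)) :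
  (forall i j, isint (M i j)) -> (forall i j, isint (N i j)) ->
  forall i j, isint ((M *m N) i j).
Proof. by move=> hM hN i j; rewrite mxE; apply: isint_sum => k _; apply: isintM. Qed.

Lemma isint_small a : isint a -> 0 <= a -> a < 4 ->
  [\/ a = 0, a = 1, a = 2 | a = 3].
Proof.
move=> [[k|k] ->]; last first.
  by rewrite NegzE intrN oppr_ge0 lern0.
rewrite -pmulrn => _; rewrite ltr_nat.
case: k => [|[|[|[|]]]] // _; [exact: Or41|exact: Or42|exact: Or43|exact: Or44].
Qed.
End IsInt.

Lemma subZE (R : realFieldType) (n : nat) (u v : 'cV[R]_n) p k :
  (u - p *: v) k 0 = u k 0 - p * v k 0.
Proof. by rewrite !mxE. Qed.

Lemma scaleE (R : realFieldType) (n : nat) (v : 'cV[R]_n) p k :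
  (p *: v) k 0 = p * v k 0.
Proof. by rewrite mxE. Qed.

Lemma row_mulE (R : realFieldType) (n p q : nat) (M : 'M[R]_(n, p)) (N : 'M[R]_(p, q)) i j :
  (row i M *m N) 0 j = (M *m N) i j.
Proof. by rewrite -row_mul mxE. Qed.

Section StepA.
Variables (W : groupType) (n : nat) (s : 'I_n -> W) (m : 'M[nat]_n).
Hypothesis hW : coxeter_system s m.
Hypothesis hm : crystallographic m.
Local Notation lens := (len s).

Definition adjoin (K : {set 'I_n}) (r : W) (o : option {j | j \in K}) : W :=
  if o is Some j then s (val j) else r.

Lemma adjoin_inW K r z : inW s K z -> gen (adjoin (K := K) r) z.
Proof.
case=> w hw <-; elim: w hw => [|i w IH] /= => [_|/andP[iK hw]]; first by exists [::].
apply: gen_mul; last exact: IH.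
by have := gen_g (adjoin (K := K) r) (Some (exist _ i iK)).
Qed.

Lemma adjoin_sub (K : {set 'I_n}) (r r' : W) z :
  gen (adjoin (K := K) r') r ->
  gen (adjoin (K := K) r) z -> gen (adjoin (K := K) r') z.
Proof.
move=> hr [w <-]; elim: w => [|o w IH] /=; first by exists [::].
apply: gen_mul => //; case: o => [j|//].
exact: (gen_g (adjoin (K := K) r') (Some j)).
Qed.

Section AnyRep.
Variables (R : realFieldType) (A : 'M[R]_n) (gA : gcm m A).
Variables (rho : W -> 'M[R]_n) (hr : representation s A rho).

(** A functional vanishing on the simple roots of [K] and on the root of the
    additional reflection is invariant under the group that they generate, so
    it vanishes on the simple roots of [J]; suitable functionals supported on
    [J] but not on [K] give both claims. *)
Lemma new_coef (K J : {set 'I_n}) x t s0 :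
  (forall k, k \in J -> gen (adjoin (K := K) (x * s t * x^-1)%g) (s k)) ->
  s0 \in J -> s0 \notin K ->
  rootv rho x t s0 0 != 0 /\ forall k, k \in J -> k \notin K -> k = s0.
Proof.
move=> hJ s0J s0K.
have fix0 (f : 'rV[R]_n) : (forall j, j \in K -> f 0 j = 0) ->
    (f *m rootv rho x t) 0 0 = 0 -> forall k, k \in J -> f 0 k = 0.
  move=> fK fr k kJ; have fg z : gen (adjoin (K := K) (x * s t * x^-1)%g) z ->
      f *m rho z = f.
    case=> w <-; elim: w => [|o w IH] /=; first by rewrite (rho1 hW gA hr) mulmx1.
    rewrite (repM hr) mulmxA.
    have -> : f *m rho (adjoin (K := K) (x * s t * x^-1)%g o) = f; last exact: IH.
    case: o => [[j jK]|] /=.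
      by rewrite (repS hr) refl_mulr mul_basis fK ?scale0r ?subr0.
    by rewrite (rho_conj hW gA hr) refl_mulr fr scale0r subr0.
  have := fg _ (hJ k kJ); rewrite (repS hr) refl_mulr mul_basis.
  move/matrixP/(_ 0 k); rewrite !mxE (gcm_diag gA).
  by move: (f 0 k) => a ha; lra.
pose g := rootv rho x t.
have nz : g s0 0 != 0.
  apply/eqP => g0.
  have h1 j : j \in K -> (delta_mx 0 s0 : 'rV[R]_n) 0 j = 0.
    move=> jK; rewrite mxE /=; case: eqP => // js.
    by rewrite -js jK in s0K.
  have h2 : ((delta_mx 0 s0 : 'rV[R]_n) *m rootv rho x t) 0 0 = 0.
    by rewrite -rowE mxE.
  have := fix0 _ h1 h2 s0 s0J; rewrite mxE !eqxx /= => /eqP.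
  by rewrite oner_eq0.
split=> // k kJ kK; apply/eqP; apply: contraT => ks.
have [a ea] : exists a, a = g s0 0 by exists (g s0 0).
have [b eb] : exists b, b = g k 0 by exists (g k 0).
pose f : 'rV[R]_n := a *: delta_mx 0 k - b *: delta_mx 0 s0.
have h1 j : j \in K -> f 0 j = 0.
  move=> jK; rewrite !mxE /=.
  have [ejk|_] := eqVneq j k; first by rewrite -ejk jK in kK.
  have [ejs|_] := eqVneq j s0; first by rewrite -ejs jK in s0K.
  by rewrite !mulr0 subrr.
have h2 : (f *m rootv rho x t) 0 0 = 0.
  have rowg l : row l g 0 0 = g l 0 by rewrite mxE.
  rewrite mulmxBl -!scalemxAl -!rowE subZE rowg -ea.
  by move: (rowg k); rewrite -eb; move: (row k g) => v; rewrite mxE => ->; rewrite mulrC subrr.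
have := fix0 f h1 h2 k kJ; rewrite /f !mxE !eqxx /= (negPf ks) mulr0 mulr1 subr0.
by move/eqP; rewrite ea (negPf nz).
Qed.

(** If the pairing were positive, conjugation by [s j] would shorten the
    reflection by two: both steps can be read off the coordinate at [s0], which
    [s j] does not change. *)
Lemma min_pairing x t s0 j : 0 < rootv rho x t s0 0 -> j != s0 ->
  (lens (x * s t * x^-1) <= lens (s j * (x * s t * x^-1) * s j))%N%g ->
  (row t A *m rho x^-1%g) 0 j <= 0.
Proof.
set r := (x * s t * x^-1)%g; set p := (_ *m _) 0 j => d0 js le.
rewrite leNgt; apply/negP => p0.
have rV : (r^-1 = r)%g by rewrite /r !invgM invgK (sV hW) mulgA.
have js' : s0 == j = false by rewrite eq_sym (negPf js).
have rj : rootv rho r j = basis j - p *: rootv rho x t.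
  rewrite /rootv -/(rho r) (rho_conj_mul hW gA hr) mul_basis //.
have neg1 : negv (rootv rho r j).
  apply: (root_coef_neg hW hm gA hr (k := s0)).
  by rewrite rj subZE basisE js' sub0r oppr_lt0 mulr_gt0.
have l1 := root_neg_len hW hm gA hr neg1.
have neg2 : negv (rootv rho (s j * r)%g j).
  apply: (root_coef_neg hW hm gA hr (k := s0)).
  rewrite (rootvM hr) (rep_s_entry hr) js' mulr0 subr0 rj subZE basisE js'.
  rewrite sub0r oppr_lt0.
  by rewrite mulr_gt0.
have l2 := root_neg_len hW hm gA hr neg2.
have e : lens (s j * r)%g = lens (r * s j)%g.
  by rewrite -(lenV hW) invgM rV (sV hW).
by have := ltn_trans (leq_ltn_trans le l2) (eq_ind_r (fun k => k < _)%N l1 e); rewrite ltnn.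
Qed.

(** Both vanishing conditions express that [s j] commutes with the reflection. *)
Lemma pairing_zero x t s0 j : 0 < rootv rho x t s0 0 -> j != s0 ->
  (row t A *m rho x^-1%g) 0 j = 0 -> (A *m rootv rho x t) j 0 = 0.
Proof.
set r := (x * s t * x^-1)%g => d0 js p0.
have js' : s0 == j = false by rewrite eq_sym (negPf js).
have rj : rootv rho r j = 1 *: basis j.
  by rewrite /rootv (rho_conj_mul hW gA hr) mul_basis p0 scale0r subr0 scale1r.
have rV : (r^-1 = r)%g by rewrite /r !invgM invgK (sV hW) mulgA.
have := conj_eq_simple hW hm gA hr rj => /(congr1 (fun z => z * r)%g).
rewrite mulgVK => com.
have : ((s j * x) * s t * (s j * x)^-1 = x * s t * x^-1)%g.
  rewrite invgM (sV hW) -/r.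
  have -> : (s j * x * s t * (x^-1 * s j) = s j * r * s j)%g by rewrite /r !mulgA.
  by rewrite -com -mulgA (sK hW) mulg1.
case/(root_conj hW gA hr) => c hc.
have c1 : c = 1.
  have := congr1 (fun M : 'cV_n => M s0 0) hc.
  rewrite (rootvM hr) (rep_s_entry hr) js' mulr0 subr0 scaleE.
  move: d0; move: (rootv _ _ _ _ _) => a a0 ha.
  by apply: (mulIf (lt0r_neq0 a0)); rewrite mul1r.
have := congr1 (fun M : 'cV_n => M j 0) hc.
rewrite (rootvM hr) (rep_s_entry hr) eqxx mulr1 c1 scale1r => h.
by lra.
Qed.

End AnyRep.

(** The coroots are the roots of the representation attached to the transposed
    matrix.  Through this identity, statements about the values of coroots on
    roots may be applied with the two roles exchanged. *)
Lemma duality (R : realFieldType) (A : 'M[R]_n) (gA : gcm m A) rho rhoT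
  (hr : representation s A rho) (hrT : representation s A^T rhoT) x :
  A *m rho x = (rhoT x^-1%g)^T *m A.
Proof.
have gAT := gcm_tr hW gA.
have [w <-] := all_gen hW x; elim: w => [|i w IH] /=.
  by rewrite invg1 (rho1 hW gA hr) (rho1 hW gAT hrT) trmx1 mulmx1 mul1mx.
rewrite invgM (repM hr) (repM hrT) (sV hW) trmx_mul -[RHS]mulmxA -IH.
rewrite !mulmxA; congr (_ *m _).
rewrite (repS hr) (repS hrT) /refl mulmxBr mulmx1 linearB /= trmx1 mulmxBl mul1mx.
congr (_ - _); rewrite mulmxA -colE trmx_mul -mulmxA trmx_delta -rowE.
by rewrite tr_row trmxK.
Qed.

Section Integral.
Variables (R : realFieldType).

(** An integral factorisation of [bond (m i j)], oriented by the order of the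
    indices; [int_gcm] need not be symmetrisable. *)
Definition int_entry i j : nat :=
  if m i j == 2 then 0 else if m i j == 3 then 1
  else if m i j == 4 then (if (i < j)%N then 1 else 2)
  else if m i j == 6 then (if (i < j)%N then 1 else 3) else 2.

Definition int_gcm : 'M[R]_n :=
  \matrix_(i, j) if i == j then 2 else - (int_entry i j)%:R.

Lemma int_gcmP : gcm m int_gcm.
Proof.
split=> [i|i j ij|i j ij|i j ij mij]; rewrite !mxE ?eqxx //.
- by rewrite (negPf ij) oppr_le0 ler0n.
- rewrite (negPf ij) eq_sym (negPf ij) mulrNN -natrM; congr (_%:R).
  rewrite /int_entry /bond (cox_sym hW j i).
  have : (i < j)%N || (j < i)%N by rewrite -neq_ltn.
  by case: (ltngtP i j) => // _ _; do !case: eqP.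
- by rewrite (negPf ij) /int_entry mij oppr0.
Qed.

Lemma int_gcm_int i j : isint (int_gcm i j).
Proof.
by rewrite mxE; case: eqP => _; [exact: (isint_nat R 2) | apply/isintN/isint_nat].
Qed.

Lemma rep_int (rho : W -> 'M[R]_n) : representation s int_gcm rho ->
  forall x i j, isint (rho x i j).
Proof.
move=> hr x; have [w <-] := all_gen hW x; elim: w => [|k w IH] /= i j.
  by rewrite (rho1 hW int_gcmP hr) mxE; apply: isint_nat.
rewrite (repM hr); apply: isint_mul => // {}i {}j.
rewrite (repS hr) /refl !mxE; apply: isintD; first exact: isint_nat.
apply: isintN; apply: isint_sum => l _; apply: isintM; rewrite mxE.
  exact: isint_nat.
exact: int_gcm_int.
Qed.
End Integral.

(** Let [r'] be a conjugate of [r] under [W_K] of minimal length, and [d] its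
    positive root.  The pairings [p] and [q] of [d] with the simple roots of [K]
    are nonpositive by minimality, and they are integers.  Hence each product
    [p j * q j] is 0, 1, 2, 3 or at least 4, and in the first cases [r'] and
    [s j] satisfy the expected relation, by faithfulness.  So Tits' theorem
    holds for the family of [s j], [j] in [K], and [r'].  The simple reflection
    [s s0] is in the group that they generate and maps one of their roots to a
    negative vector; this can only be [d], and then [d] is proportional to the
    simple root of [s s0].  Without integrality the result fails, for instance
    in the dihedral group of order 10. *)
Lemma new_reflection (K J : {set 'I_n}) x t (r := (x * s t * x^-1)%g) :
  K \subset J -> inW s J r -> ~ inW s K r ->
  (forall k, k \in J -> gen (adjoin (K := K) r) (s k)) ->
  exists s0 u, [/\ s0 \in J, s0 \notin K, inW s K u & (r = u^-1 * s s0 * u)%g].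
Proof.
move=> KJ rJ rK hJ.
have [s0 s0J s0K] : exists2 s0, s0 \in J & s0 \notin K.
  apply: contrapT => no; apply: rK; apply: inW_sub rJ.
  by apply/fintype.subsetP => k kJ; apply: contraT => kK; case: no; exists k.
pose A := int_gcm rat; have gA : gcm m A := int_gcmP rat.
have gT := gcm_tr hW gA.
have [rho hr] := representation_exists hW hm gA.
have [rhoT hrT] := representation_exists hW hm gT.
wlog pos : x @r rJ rK hJ / 0 < rootv rho x t s0 0.
  move=> wl; have [nz _] := new_coef gA hr hJ s0J s0K.
  case: (ltgtP (rootv rho x t s0 0) 0) nz => // h _; last exact: wl.
  have e : (x * s t * s t * (x * s t)^-1)%g = r.
    by rewrite invgM !mulgA -(mulgA x) (sK hW) mulg1 (sV hW).
  have := wl (x * s t)%g; rewrite /= e => /(_ rJ rK hJ).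
  rewrite (root_s gA hr) mxE oppr_gt0 => /(_ h).
  exact.
pose P (k : nat) := `[< exists2 u, inW s K u & lens (u * r * u^-1)%g = k >].
have exP : exists k : nat, P k.
  by exists (lens (1 * r * 1^-1)%g); apply/asboolP; exists 1%g => //; exact: inW1.
case: (ex_minnP exP) => k /asboolP[u uK lu] mink; rewrite -{k}lu in mink.
exists s0, u; split=> //.
pose y := (u * x)%g; pose r' := (y * s t * y^-1)%g.
have r'E : (r' = u * r * u^-1)%g by rewrite /r' /y /r invgM !mulgA.
rewrite -r'E in mink.
suff r's : r' = s s0 by rewrite -r's r'E !mulgA mulVg mul1g mulgVK.
pose d := rootv rho y t.
have d0 : 0 < d s0 0.
  by rewrite /d (rootvM hr) (inW_supp hW gA hr _ uK).
have dpos : posv d := root_coef_pos hW hm gA hr d0.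
have hJ' k : k \in J -> gen (adjoin (K := K) r') (s k).
  move=> kJ; apply: adjoin_sub (hJ k kJ).
  have -> : (r = u^-1 * r' * u)%g by rewrite r'E !mulgA mulVg mul1g mulgVK.
  apply: gen_mul; last exact: adjoin_inW.
  apply: gen_mul; first by apply: adjoin_inW; apply: (inWV hW).
  exact: (gen_g (adjoin (K := K) r') None).
have [_ uniqJ] := new_coef gA hr hJ' s0J s0K.
have ls j : j \in K -> (lens r' <= lens (s j * r' * s j)%g)%N.
  move=> jK; apply: mink; apply/asboolP; exists (s j * u)%g.
    by apply: inWM => //; apply: inW_s.
  by rewrite invgM (sV hW) r'E !mulgA.
have Ks j : j \in K -> j != s0 by apply: contraTneq => ->.
have dT0 : 0 < rootv rhoT y t s0 0.
  have [nz _] := new_coef gT hrT hJ' s0J s0K.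
  by rewrite lt_def nz; exact: (root_pos hW hm gT hrT (root_pos_len hW hm gA hr dpos)).
pose p j := (row t A *m rho y^-1%g) 0 j; pose q j := (A *m d) j 0.
have qE j : q j = (row t A^T *m rhoT y^-1%g) 0 j.
  rewrite /q /d /rootv mulmxA (duality gA hr hrT) mul_basis.
  have -> : ((rhoT y^-1%g)^T *m A) j t = (A^T *m rhoT y^-1%g) t j.
    have := congr1 (fun M : 'M_n => M t j) (trmx_mul (rhoT y^-1%g)^T A).
    by rewrite trmxK [LHS]mxE.
  by rewrite row_mulE.
have pE j : p j = (A^T *m rootv rhoT y t) j 0.
  rewrite /rootv mulmxA mul_basis /p row_mulE.
  have := duality gA hr hrT y^-1%g; rewrite invgK => ->.
  have := congr1 (fun M : 'M_n => M j t) (trmx_mul (rhoT y)^T A).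
  by rewrite trmxK [LHS]mxE.
have p0 j : j \in K -> p j <= 0.
  by move=> jK; apply: (min_pairing gA hr d0) => //; [apply: Ks | apply: ls].
have q0 j : j \in K -> q j <= 0.
  by move=> jK; rewrite qE; apply: (min_pairing gT hrT dT0); [apply: Ks | apply: ls].
have pq0 j : j \in K -> p j = 0 -> q j = 0.
  by move=> jK; apply: (pairing_zero gA hr d0); apply: Ks.
have qp0 j : j \in K -> q j = 0 -> p j = 0.
  by move=> jK; rewrite pE qE; apply: (pairing_zero gT hrT dT0); apply: Ks.
have pint j : isint (p j).
  apply: isint_mul; last by move=> *; apply: (rep_int hr).
  by move=> *; rewrite mxE; apply: int_gcm_int.
have qint j : isint (q j).
  apply: isint_mul; first exact: int_gcm_int.
  by move=> i l; rewrite [l]ord1 root_entry; apply: (rep_int hr).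
have rd : rho r' = refl d (row t A *m rho y^-1%g) by rewrite (rho_conj hW gA hr).
have fd : (row t A *m rho y^-1%g *m d) 0 0 = 2.
  rewrite /d /rootv -mulmxA (mulmxA (rho _)) (rhoVK hW gA hr) mul1mx.
  by rewrite mul_basis mxE (gcm_diag gA).
have fe j : (row j A *m (basis j : 'cV_n)) 0 0 = 2.
  by rewrite mul_basis mxE (gcm_diag gA).
have qrow j : (row j A *m d) 0 0 = q j by rewrite row_mulE.
have prow j : (row t A *m rho y^-1%g *m (basis j : 'cV_n)) 0 0 = p j.
  by rewrite mul_basis.
have rels j : j \in K -> 4 <= p j * q j \/
  [/\ p j = 0, q j = 0 & ((r' * s j) ^+ 2 = 1)%g] \/
  exists m' e : nat, [/\ (m', e) \in [:: (3, 1); (4, 2); (6, 3)]%N,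
    p j * q j = e%:R & ((r' * s j) ^+ m' = 1)%g].
  move=> jK; case: (leP 4 (p j * q j)) => [|lt4]; first by left.
  have rX z k : rho (z ^+ k)%g = rho z ^+ k.
    by elim: k => [|k IH]; rewrite ?expg0 ?(rho1 hW gA hr) // expgS exprS (repM hr) IH.
  have ord2 : p j = 0 -> q j = 0 -> ((r' * s j) ^+ 2 = 1)%g.
    move=> pj qj; apply: (rho_inj hW hm gA hr).
    rewrite rX (rho1 hW gA hr) (repM hr) rd (repS hr).
    by apply: refl_order2; rewrite ?prow ?qrow.
  have ord (m' e : nat) : (m', e) \in [:: (3, 1); (4, 2); (6, 3)]%N ->
      p j * q j = e%:R -> ((r' * s j) ^+ m' = 1)%g.
    move=> me pq; apply: (rho_inj hW hm gA hr).
    rewrite rX (rho1 hW gA hr) (repM hr) rd (repS hr).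
    by apply: refl_order me; rewrite ?prow ?qrow.
  have [|pq|pq|pq|pq] := isint_small (isintM (pint j) (qint j)) _ lt4.
  - by rewrite mulr_le0 // ?p0 ?q0.
  - right; left; have [pj qj] : p j = 0 /\ q j = 0; last by split=> //; exact: ord2.
    case/eqP: pq; rewrite mulf_eq0 => /orP[]/eqP z; split=> //.
      exact: pq0. exact: qp0.
  - by right; right; exists 3, 1; split=> //; apply: (ord _ 1).
  - by right; right; exists 4, 2; split=> //; apply: (ord _ 2).
  - by right; right; exists 6, 3; split=> //; apply: (ord _ 3).
(* Tits' theorem for the roots [b]: the simple roots of [K], and [d] *)
pose g := adjoin (K := K) r'.
have gKK o : (g o * g o = 1)%g.
  case: o => [j|]; first exact: (sK hW).
  have rr (z : W) : (z * s t * z^-1 * (z * s t * z^-1) = 1)%g.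
    by rewrite !mulgA mulgVK -(mulgA z) (sK hW) mulg1 mulgV.
  exact: rr.
pose b (o : option {j | j \in K}) := if o is Some j then basis (val j) else d.
pose c (o o' : option {j | j \in K}) : rat := match o, o' with
  | Some i, Some j => - A (val i) (val j)
  | None, Some j => - p (val j)
  | Some j, None => - q (val j)
  | None, None => 0
  end.
have Vpq (z z' : W) k : (z * z = 1)%g -> (z' * z' = 1)%g ->
    ((z * z') ^+ k = 1)%g -> ((z' * z) ^+ k = 1)%g.
  move=> zz zz' h; rewrite -[(z' * z)%g]invgK invgM.
  by rewrite (mulg1_eq zz) (mulg1_eq zz') expVgn h invg1.
have cone o x' : gen g x' -> (len g x' <= len g (x' * g o)%g)%N ->
    posv (rho x' *m b o).
  move=> gx hx.
  apply: (@tits_cone rat _ W _ g (fun z v => rho z *m v) b c _ _ _ _ _ _ _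
    _ _ (@posv rat n) _ _ _ x' o gx hx).
  - by move=> v; rewrite (rho1 hW gA hr) mul1mx.
  - by move=> z z' v; rewrite (repM hr) mulmxA.
  - by move=> z v v'; rewrite mulmxDr.
  - by move=> z a v; rewrite scalemxAr.
  - exact: gKK.
  - case=> [j|] /=; first exact: (rep_s_basis hW gA hr).
    exact: (conj_root hW gA hr).
  - case=> [i|] [j|] //= ij.
    + by rewrite (rep_s_mul hr) mul_basis scaleNr.
    + by rewrite (rep_s_mul hr) scaleNr.
    + by rewrite rd refl_mul prow scaleNr.
  - case=> [i|] [j|] //= ij; rewrite oppr_ge0.
    + by rewrite (gcm_le0 gA).
    + by apply: q0; apply: valP.
    + by apply: p0; apply: valP.
  - case=> [i|] [j|] //= ij; rewrite /dihedral_ok /=.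
    + exact: (dihedral_simple hW hm gA (ij : val i != val j)).
    + rewrite mulrNN mulrC; have := rels _ (valP i) => -[h|[[pi qi h]|]]; first by left.
        by right; left; split; rewrite ?pi ?qi ?oppr0 //; apply: Vpq h; [exact: (gKK None) | exact: (sK hW)].
      move=> [m' [e [me pq h]]]; right; right; exists m', e; split=> //.
      by apply: Vpq h; [exact: (gKK None) | exact: (sK hW)].
    + rewrite mulrNN; have := rels _ (valP j) => -[h|[[pi qi h]|]]; first by left.
        by right; left; split; rewrite ?pi ?qi ?oppr0.
      by move=> [m' [e [me pq h]]]; right; right; exists m', e.
  - case=> [j|] //= k; by rewrite basisE ler0n.
  - by move=> v v' hv hv' k; rewrite mxE addr_ge0.
  - by move=> a v ha hv k; rewrite scaleE mulr_ge0.
(* a right descent of [s s0] for the new generating family *)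
have s1 : s s0 <> 1%g.
  by move=> s1; have /(cox_invol hW s0 1) := s1.
have [o lo] := gen_descent gKK (hJ' _ s0J) s1.
have so : (s s0 * g o * g o = s s0)%g by rewrite -mulgA gKK mulg1.
have gso : gen g (s s0 * g o)%g by apply: gen_mul; [exact: hJ' | exact: gen_g].
have : posv (rho (s s0 * g o)%g *m b o) by apply: cone => //; rewrite so ltnW.
rewrite (repM hr) -mulmxA.
have {lo so gso} -> : rho (g o) *m b o = - b o.
  by case: o {lo so gso} => [j|]; [exact: (rep_s_basis hW gA hr) | exact: (conj_root hW gA hr)].
rewrite mulmxN; case: o => [[j jK]|] /= neg.
  have := neg j; rewrite mxE (rep_s_entry hr) (negPf (Ks j jK)) mulr0 subr0.
  by rewrite basisE eqxx oppr_ge0 ler10.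
have d_s0 : d = d s0 0 *: basis s0.
  apply/matrixP => k l; rewrite [l]ord1 {l} scaleE basisE.
  have [->|ks] := eqVneq k s0; first by rewrite mulr1.
  rewrite mulr0; have [kK|kK] := boolP (k \in K).
    have := neg k; rewrite mxE (rep_s_entry hr) (negPf ks) mulr0 subr0 oppr_ge0 => h.
    by apply/eqP; rewrite eq_le h dpos.
  have kJ : k \notin J by apply: contra ks => kJ; apply/eqP/uniqJ.
  have r'J : inW s J r'.
    rewrite r'E; apply: inWM; last by apply: (inWV hW); apply: inW_sub uK.
    by apply: inWM => //; apply: inW_sub uK.
  have := inW_supp hW gA hr d r'J kJ; rewrite (conj_root hW gA hr) mxE => h.
  by lra.
exact: (conj_eq_simple hW hm gA hr d_s0).
Qed.
End StepA.

(** * The symmetric representation and its invariant form *)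

Section Symmetric.
Variables (W : groupType) (n : nat) (s : 'I_n -> W) (m : 'M[nat]_n).
Hypothesis hW : coxeter_system s m.
Hypothesis hm : crystallographic m.
Variable R : rcfType.

Definition sym_gcm : 'M[R]_n :=
  \matrix_(i, j) if i == j then 2 else - Num.sqrt (bond (m i j))%:R.
Local Notation A := sym_gcm.

Lemma sym_gcmP : gcm m A.
Proof.
split=> [i|i j ij|i j ij|i j ij mij]; rewrite !mxE ?eqxx //.
- by rewrite (negPf ij) oppr_le0 sqrtr_ge0.
- rewrite (negPf ij) eq_sym (negPf ij) mulrNN (cox_sym hW j i) -expr2.
  by rewrite sqr_sqrtr ?ler0n.
- by rewrite (negPf ij) mij sqrtr0 oppr0.
Qed.

Lemma sym_gcm_tr : A^T = A.
Proof. by apply/matrixP => i j; rewrite !mxE eq_sym (cox_sym hW j i). Qed.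

Lemma sym_gcm_off i j i' j' : i != j -> i' != j' -> m i j = m i' j' ->
  A i j = A i' j'.
Proof. by move=> ij ij' h; rewrite !mxE (negPf ij) (negPf ij') h. Qed.

Variables (rho : W -> 'M[R]_n) (hr : representation s A rho).
Local Notation rootv := (rootv rho).

Definition bform (u v : 'cV[R]_n) : R := (u^T *m A *m v) 0 0.

Lemma rho_form x : (rho x)^T *m A *m rho x = A.
Proof.
have hrT : representation s A^T rho by rewrite sym_gcm_tr.
rewrite -mulmxA (duality hW sym_gcmP hr hrT) mulmxA -trmx_mul.
by rewrite (rhoVK hW sym_gcmP hr) trmx1 mul1mx.
Qed.

Lemma form_rho x u v : bform (rho x *m u) (rho x *m v) = bform u v.
Proof. by rewrite /bform trmx_mul !mulmxA -(mulmxA u^T) -(mulmxA u^T) rho_form. Qed.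

Lemma form_rhoV x u v : bform (rho x *m u) v = bform u (rho x^-1%g *m v).
Proof.
by rewrite -(form_rho x u) mulmxA (rhoKV hW sym_gcmP hr) mul1mx.
Qed.

Lemma form_basis i v : bform (basis i) v = (A *m v) i 0.
Proof. by rewrite /bform trmx_delta -rowE row_mulE. Qed.

Lemma formC u v : bform u v = bform v u.
Proof.
rewrite /bform -[RHS]/(((v^T *m A *m u) : 'M_1) 0 0) -[in RHS](trmxK u).
have -> : v^T *m A *m u^T^T = (u^T *m A *m v)^T.
  by rewrite !trmx_mul sym_gcm_tr mulmxA.
by rewrite [RHS]mxE.
Qed.

Lemma formZl a u v : bform (a *: u) v = a * bform u v.
Proof. by rewrite /bform linearZ /= -!scalemxAl scaleE. Qed.

Lemma formZr a u v : bform u (a *: v) = a * bform u v.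
Proof. by rewrite formC formZl formC. Qed.

Lemma form_subr u v w c : bform u (v - c *: w) = bform u v - c * bform u w.
Proof. by rewrite /bform mulmxBr -scalemxAr subZE. Qed.

Lemma form_bb i j : bform (basis i) (basis j) = A i j.
Proof. by rewrite form_basis mul_basis. Qed.

Lemma form_sum u v : bform u v = \sum_i v i 0 * bform u (basis i).
Proof.
rewrite /bform mxE; apply: eq_bigr => i _.
by rewrite mulrC mul_basis.
Qed.

Lemma root_norm x i : bform (rootv x i) (rootv x i) = 2.
Proof. by rewrite form_rho form_bb (gcm_diag sym_gcmP). Qed.

(** All roots have the same norm. *)
Lemma root_unit x t y k c : rootv x t = c *: rootv y k -> c = 1 \/ c = -1.
Proof.
move=> h; have := root_norm x t; rewrite h formZl formZr root_norm => hc.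
have : (c - 1) * (c + 1) = 0 by lra.
move/eqP; rewrite mulf_eq0 => /orP[]/eqP h'; [left|right]; lra.
Qed.

Lemma root_conj_sign x t y k : (x * s t * x^-1 = y * s k * y^-1)%g ->
  rootv x t = rootv y k \/ rootv x t = - rootv y k.
Proof.
move=> /(root_conj hW sym_gcmP hr)[c h].
case: (root_unit h) => c1; rewrite c1 in h; first by left; rewrite scale1r in h.
by right; rewrite scaleN1r in h.
Qed.

(** The pairing of two roots is known up to sign as soon as their reflections
    are simultaneously conjugate to simple ones. *)
Lemma form_pair x p y q w a b i j : i != j -> a != b -> m a b = m i j ->
  (x * s p * x^-1 = w * s a * w^-1)%g -> (y * s q * y^-1 = w * s b * w^-1)%g ->
  `|bform (rootv x p) (rootv y q)| = - A i j.
Proof.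
move=> ij ab mab /root_conj_sign hx /root_conj_sign hy.
have fN u v : bform (- u) v = - bform u v by rewrite -scaleN1r formZl mulN1r.
have fN' u v : bform v (- u) = - bform v u by rewrite -scaleN1r formZr mulN1r.
have -> : `|bform (rootv x p) (rootv y q)| = `|bform (rootv w a) (rootv w b)|.
  by case: hx => ->; case: hy => ->; rewrite ?fN ?fN' ?opprK ?normrN.
rewrite form_rho form_bb (sym_gcm_off ab ij) //.
by rewrite ler0_norm // (gcm_le0 sym_gcmP).
Qed.
End Symmetric.

(** * Automorphisms preserving parabolic subgroups *)

Section Automorphisms.
Variables (W : groupType) (n : nat) (s : 'I_n -> W) (m : 'M[nat]_n).
Hypothesis hW : coxeter_system s m.
Hypothesis hm : crystallographic m.
Local Open Scope classical_set_scope.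

Definition conjugate (X Y : set W) := exists v, X = conj_set v Y.

Lemma conj_setM v w (X : set W) : conj_set (v * w)%g X = conj_set v (conj_set w X).
Proof.
apply/seteqP; split=> [_ [x Xx <-]|_ [_ [x Xx <-] <-]].
  by exists (w * x * w^-1)%g; [exists x|rewrite invgM !mulgA].
by exists x => //; rewrite invgM !mulgA.
Qed.

Lemma conj_set1 (X : set W) : conj_set 1%g X = X.
Proof.
apply/seteqP; split=> [_ [x Xx <-]|x Xx]; first by rewrite mul1g invg1 mulg1.
by exists x; rewrite ?mul1g ?invg1 ?mulg1.
Qed.

Lemma conjugate_refl X : conjugate X X.
Proof. by exists 1%g; rewrite conj_set1. Qed.

Lemma conjugate_sym X Y : conjugate X Y -> conjugate Y X.
Proof. by move=> [v ->]; exists v^-1%g; rewrite -conj_setM mulVg conj_set1. Qed.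

Lemma conjugate_trans Y X Z : conjugate X Y -> conjugate Y Z -> conjugate X Z.
Proof. by move=> [v ->] [w ->]; exists (v * w)%g; rewrite conj_setM. Qed.

Definition std (K : {set 'I_n}) : set W := [set x | inW s K x].

Definition preserves_parabolics (alpha : W -> W) :=
  forall K, exists J, conjugate (alpha @` std K) (std J).

(** For the full set of indices this says that [alpha] is inner-by-graph. *)
Definition simple_up_to_conj (alpha : W -> W) (K : {set 'I_n}) :=
  exists w t, forall i, i \in K -> alpha (s i) = (w * s (t i) * w^-1)%g.

Section Image.
Variable alpha : W -> W.
Hypothesis alphaM : {morph alpha : x y / (x * y)%g}.

Lemma morph1 : alpha 1%g = 1%g.
Proof. by apply: (@mulgI _ (alpha 1%g)); rewrite -alphaM !mulg1. Qed.

Lemma morphV x : alpha x^-1%g = (alpha x)^-1%g.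
Proof. by apply/esym/mulg1_eq; rewrite -alphaM mulgV morph1. Qed.

Lemma image_conj v (X : set W) :
  alpha @` conj_set v X = conj_set (alpha v) (alpha @` X).
Proof.
apply/seteqP; split=> [_ [_ [x Xx <-] <-]|_ [_ [x Xx <-] <-]].
  by exists (alpha x); [exists x|rewrite !alphaM morphV].
by exists (v * x * v^-1)%g; [exists x|rewrite !alphaM morphV].
Qed.

Lemma conjugate_image X Y : conjugate X Y -> conjugate (alpha @` X) (alpha @` Y).
Proof. by move=> [v ->]; exists (alpha v); rewrite image_conj. Qed.
End Image.

Section Inverse.
Variables alpha beta : W -> W.
Hypothesis alphaM : {morph alpha : x y / (x * y)%g}.
Hypothesis betaM : {morph beta : x y / (x * y)%g}.
Hypothesis alphaK : cancel alpha beta.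

(** On the finitely many conjugacy classes of standard subgroups [alpha] induces
    an injective self-map, hence a permutation.  Here [f K] is a standard
    subgroup conjugate to the image of [K], and two iterates of [f] agree on
    [K]. *)
Lemma preserves_parabolics_inv :
  preserves_parabolics alpha -> preserves_parabolics beta.
Proof.
move=> /choice[f hf] K.
have imK (X : set W) : beta @` (alpha @` X) = X.
  apply/seteqP; split=> [_ [_ [x Xx <-] <-]|x Xx]; first by rewrite alphaK.
  by exists (alpha x); rewrite ?alphaK //; exists x.
pose F (X : set W) := alpha @` X.
have iterF k L : conjugate (iter k F (std L)) (std (iter k f L)).
  elim: k => [|k IH] /=; first exact: conjugate_refl.
  exact: conjugate_trans (conjugate_image alphaM IH) (hf _).
have [a [c eac]] : exists a c : nat, iter a f K = iter (a + c.+1) f K.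
  pose g (i : 'I_(#|{set 'I_n}|.+1)) := iter i f K.
  have /injectivePn[i [j ij gij]] : ~~ injectiveb g.
    apply/negP => /injectiveP/leq_card; rewrite card_ord.
    by rewrite ltnn.
  wlog lt : i j ij gij / (i < j)%N.
    move=> wl; have : (i < j)%N || (j < i)%N by rewrite -neq_ltn.
    by case/orP => /wl; apply=> //; rewrite eq_sym.
  by exists i, (j - i.+1)%N; rewrite addnS -addSn subnKC.
have : conjugate (iter a F (std K)) (iter a F (iter c.+1 F (std K))).
  apply: (conjugate_trans (iterF a K)); rewrite eac -iterD.
  exact: conjugate_sym.
have cancel_iter k X Y : conjugate (iter k F X) (iter k F Y) -> conjugate X Y.
  elim: k => [//|k IH] /= /(conjugate_image betaM); rewrite /F !imK; exact: IH.
move/cancel_iter => h; exists (iter c f K).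
have := conjugate_trans h (conjugate_image alphaM (iterF c K)).
by move/(conjugate_image betaM); rewrite imK.
Qed.
End Inverse.

Section NormalForm.
Variables alpha beta : W -> W.
Hypothesis alphaM : {morph alpha : x y / (x * y)%g}.
Hypothesis alphaK : cancel alpha beta.
Hypothesis alphaPP : preserves_parabolics alpha.

Lemma alpha_inj : injective alpha. Proof. exact: can_inj alphaK. Qed.

Lemma s_neq1 i : s i <> 1%g.
Proof. by move=> h; have /(cox_invol hW i 1) := h. Qed.

Lemma inW_set1 i x : inW s [set i]%SET x -> x = 1%g \/ x = s i.
Proof.
case=> w hw <-; elim: w hw => [|j w IH] /=; first by left.
rewrite inE => /andP[/eqP-> /IH[->|->]]; [right|left].
  by rewrite mulg1.
exact: (sK hW).
Qed.

(** A standard subgroup of order 2 is generated by a simple reflection. *)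
Lemma simple_up_to_conj1 i : simple_up_to_conj alpha [set i]%SET.
Proof.
have [J [v hv]] := alphaPP [set i]%SET.
have si : (alpha @` std [set i]%SET) (alpha (s i)).
  by exists (s i) => //; apply: inW_s; rewrite inE.
have [j jJ] : exists j, j \in J.
  move: si; rewrite hv => -[z [w hw <-] h].
  case: w hw h => [|j w] /= => [_|/andP[jJ _] _]; last by exists j.
  rewrite mulg1 mulgV => h; have := @s_neq1 i; case.
  by apply: alpha_inj; rewrite morph1.
have : conj_set v (std J) (v * s j * v^-1)%g by exists (s j) => //; apply: inW_s.
rewrite -hv => -[x /inW_set1[->|->] h]; last first.
  by exists v, (fun=> j) => k; rewrite inE => /eqP->.
have := @s_neq1 j; case; move: h; rewrite morph1 // => /esym h.
have := congr1 (fun z => v^-1 * z * v)%g h.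
by rewrite !mulgA mulVg mul1g mulgVK mulg1 mulVg.
Qed.

Lemma word_imset (K : {set 'I_n}) (t : 'I_n -> 'I_n) u : inW s (t @: K)%SET u ->
  exists2 w, all (mem K) w & u = wprod s (map t w).
Proof.
case=> w hw <-; elim: w hw => [|i w IH] /= => [_|]; first by exists [::].
case/andP=> /imsetP[k kK ->] /IH[w' hw' ->].
by exists (k :: w') => //=; rewrite kK.
Qed.

Lemma morph_word (K : {set 'I_n}) (t : 'I_n -> 'I_n) v w :
  (forall i, i \in K -> alpha (s i) = (v * s (t i) * v^-1)%g) ->
  all (mem K) w -> alpha (wprod s w) = (v * wprod s (map t w) * v^-1)%g.
Proof.
move=> h; elim: w => [|i w IH] /=; first by rewrite mulg1 mulgV morph1.
by case/andP=> iK hw; rewrite alphaM h // IH // !mulgA mulgVK.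
Qed.

(** The images of the [s i], [i] in [K], and of [s i0] generate a conjugate of
    some [W_J].  Conjugating by the shortest element of a coset of [W_J] keeps
    the former simple and puts them into [J] ([simple_in_conj]); the image of
    [s i0] is then governed by [new_reflection].  The conjugating element [u] is
    recorded as a word in [K], since it will be needed on both sides of
    [alpha]. *)
Lemma normal_form (K : {set 'I_n}) i0 : i0 \notin K -> simple_up_to_conj alpha K ->
  exists v t s0 w, [/\ forall i, i \in K -> alpha (s i) = (v * s (t i) * v^-1)%g,
    s0 \notin (t @: K)%SET, all (mem K) w &
    let u := wprod s (map t w) in
    alpha (s i0) = (v * (u^-1 * s s0 * u) * v^-1)%g].
Proof.
move=> i0K [w0 [t0 h0]].
have [J [v1 hv1]] := alphaPP (i0 |: K)%SET.
have [rho hr] := representation_exists hW hm (int_gcmP hW rat).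
have gA := int_gcmP hW rat.
have [z0 z0J pos] := coset_min hW hm gA hr J (w0^-1 * v1)%g.
have [v3 v3E] : exists v3, v3 = (w0^-1 * v1 * z0)%g by eexists.
rewrite -v3E in pos.
have [v vw] : exists v, v = (w0 * v3)%g by eexists.
have vE : (v = v1 * z0)%g by rewrite vw v3E !mulgA mulgV mul1g.
have inJ x : inW s (i0 |: K)%SET x -> inW s J (v^-1 * alpha x * v)%g.
  move=> hx; have : (alpha @` std (i0 |: K)%SET) (alpha x) by exists x.
  rewrite hv1 => -[z zJ <-].
  have -> : (v^-1 * (v1 * z * v1^-1) * v = z0^-1 * z * z0)%g.
    by rewrite vE invgM -!mulgA mulKg mulKg.
  by apply: inWM => //; apply: inWM => //; apply: (inWV hW).
have fromJ z : inW s J z -> exists2 x, inW s (i0 |: K)%SET x & alpha x = (v * z * v^-1)%g.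
  move=> zJ; have : conj_set v1 (std J) (v * z * v^-1)%g.
    exists (z0 * z * z0^-1)%g; last by rewrite vE invgM !mulgA.
    by apply: inWM; [apply: inWM | apply: (inWV hW)].
  by rewrite -hv1 => -[x hx <-]; exists x.
have sub i : i \in K -> inW s (i0 |: K)%SET (s i).
  by move=> iK; apply: inW_s; rewrite inE iK orbT.
have hj i : i \in K -> exists j, (j \in J) && (v * s j * v^-1 == alpha (s i))%g.
  move=> iK; have := inJ _ (sub i iK); set z := (_ * _ * _)%g => zJ.
  have e0 : (s (t0 i) = v3 * z * v3^-1)%g.
    by rewrite /z h0 // vw invgM !mulgA mulgV mul1g mulVg mul1g mulgVK mulgK.
  have [j jJ ej] := simple_in_conj hW hm gA hr pos zJ e0.
  by exists j; rewrite jJ h0 // ej vw invgM !mulgA /= eqxx.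
pose t i := odflt i [pick j | (j \in J) && (v * s j * v^-1 == alpha (s i))%g].
have ht i : i \in K -> t i \in J /\ (alpha (s i) = v * s (t i) * v^-1)%g.
  move=> iK; rewrite /t; case: pickP => [j /andP[jJ /eqP]|no] //.
  by have [j] := hj i iK; rewrite no.
have htE i (iK : i \in K) := (ht i iK).2.
have [w1 [t1 h1]] := simple_up_to_conj1 i0.
have {}h1 := h1 i0 (set11 i0).
pose x := (v^-1 * w1)%g; pose r := (x * s (t1 i0) * x^-1)%g.
have rE : (alpha (s i0) = v * r * v^-1)%g.
  by rewrite h1 /r /x invgM invgK !mulgA mulgV mul1g mulgK.
have rJ : inW s J r.
  have := inJ (s i0) (inW_s _ (setU11 _ _)); rewrite rE.
  by rewrite !mulgA mulVg mul1g mulgVK.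
have tJ : (t @: K)%SET \subset J.
  by apply/fintype.subsetP => _ /imsetP[i iK ->]; case: (ht i iK).
have rK : ~ inW s (t @: K)%SET r.
  move=> /word_imset[w hw rw].
  have := @inW_notin _ _ _ _ hW _ _ gA _ hr K i0; rewrite (negPf i0K).
  move=> h; have: false; last by [].
  apply: h; exists w => //; apply: alpha_inj.
  by rewrite (morph_word htE hw) -rw -rE.
have hJ k : k \in J -> gen (adjoin s (K := (t @: K)%SET) r) (s k).
  move=> kJ; have [y [w hw <-] yk] := fromJ _ (inW_s s kJ).
  have -> : (s k = v^-1 * alpha (wprod s w) * v)%g.
    by rewrite yk !mulgA mulVg mul1g mulgVK.
  elim: w hw {y yk} => [|i w IH] /= => [_|/andP[ik hw]].
    by rewrite morph1 // mulg1 mulVg; exists [::].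
  rewrite alphaM.
  have -> : (v^-1 * (alpha (s i) * alpha (wprod s w)) * v =
            (v^-1 * alpha (s i) * v) * (v^-1 * alpha (wprod s w) * v))%g.
    by rewrite !mulgA mulgK.
  apply: gen_mul; last exact: IH.
  move: ik; rewrite !inE => /orP[/eqP->|iK].
    have -> : (v^-1 * alpha (s i0) * v = r)%g.
      by rewrite rE !mulgA mulVg mul1g mulgVK.
    exact: (gen_g (adjoin s (K := (t @: K)%SET) r) None).
  have -> : (v^-1 * alpha (s i) * v = s (t i))%g.
    by rewrite htE // !mulgA mulVg mul1g mulgVK.
  by apply: adjoin_inW; apply: inW_s; apply: imset_f.
have [s0 [u [s0J s0K uK ru]]] := new_reflection hW hm tJ rJ rK hJ.
have [w hw uw] := word_imset uK.
by exists v, t, s0, w; split=> //=; rewrite -uw -ru.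
Qed.

(** In rank 2 the element [u] of [normal_form] commutes with the only simple
    reflection of [K], and may be moved to the outer conjugation. *)
Lemma simple_up_to_conj2 i j : simple_up_to_conj alpha [set i; j]%SET.
Proof.
have [->|ij] := eqVneq i j.
  by have [v [t h]] := simple_up_to_conj1 j; exists v, t => k; rewrite !inE orbb => /eqP->; apply: h; rewrite inE.
have iK : i \notin [set j]%SET by rewrite inE.
have [v [t [s0 [w [h1 h2 hw /=]]]]] := normal_form iK (simple_up_to_conj1 j).
set u := wprod s _ => h3.
have uj : (u * s (t j) = s (t j) * u)%g.
  have : inW s [set t j]%SET u.
    exists (map t w) => //; rewrite all_map; apply: sub_all hw => k /=.
    by rewrite !inE => /eqP->.
  by case/inW_set1 => ->; rewrite ?mulg1 ?mul1g.
exists (v * u^-1)%g, (fun k => if k == i then s0 else t k) => k.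
rewrite !inE => /orP[]/eqP->.
  by rewrite eqxx h3 invgM invgK !mulgA.
rewrite eq_sym (negPf ij) h1 ?inE // invgM invgK.
by rewrite -!mulgA (mulgA (s (t j))) -uj !mulgA mulgVK.
Qed.
End NormalForm.
End Automorphisms.

(** * Longest elements *)

Section LongestElement.
Variables (W : groupType) (n : nat) (s : 'I_n -> W) (m : 'M[nat]_n).
Hypothesis hW : coxeter_system s m.
Hypothesis hm : crystallographic m.
Variable R : rcfType.
Local Notation A := (sym_gcm m R).
Let gA : gcm m A := sym_gcmP hW R.
Variables (rho : W -> 'M[R]_n) (hr : representation s A rho).
Local Notation rootv := (rootv rho).
Implicit Types (x y z u : W) (i j k : 'I_n) (K : {set 'I_n}).

Lemma sym_gcm_sym i j : A i j = A j i.
Proof. by rewrite -[in LHS](sym_gcm_tr hW R) mxE. Qed.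

(** The new coordinate at [j] is minus the value of a coroot, to which each
    coordinate of [v] other than the one at [j] contributes nonpositively. *)
Lemma support_step (v : 'cV[R]_n) i j : posv v -> 0 < v i 0 -> v j 0 = 0 ->
  A j i != 0 -> i != j -> posv (rho (s j) *m v) /\ 0 < (rho (s j) *m v) j 0.
Proof.
move=> pv vi vj aji ij.
have jpos : 0 < (rho (s j) *m v) j 0.
  rewrite (rep_s_entry hr) vj eqxx mulr1 sub0r oppr_gt0 mxE (bigD1 i) //=.
  apply: ltr_wnDr; last first.
    by rewrite nmulr_rlt0 // lt_neqAle aji (gcm_le0 gA) // eq_sym.
  apply: sumr_le0 => k ki; have [->|kj] := eqVneq k j; first by rewrite vj mulr0.
  by rewrite mulr_le0_ge0 // (gcm_le0 gA) // eq_sym.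
split=> // k; have [->|kj] := eqVneq k j; first exact: ltW.
by rewrite (rep_s_entry hr) (negPf kj) mulr0 subr0.
Qed.

(** The reflection [s j] changes only the coordinate at [j], so a positive root
    made negative by it is proportional to [basis j]. *)
Lemma simple_of_sign_change x i j : posv (rootv x i) ->
  negv (rho (s j) *m rootv x i) -> rootv x i = basis j.
Proof.
move=> p q.
have h : rootv x i = rootv x i j 0 *: rootv 1%g j.
  apply/matrixP => k l; rewrite [l]ord1 scaleE (rootv1 hW gA hr) basisE.
  have [->|kj] := eqVneq k j; first by rewrite mulr1.
  rewrite mulr0; apply/eqP; rewrite eq_le p andbT.
  by have := q k; rewrite (rep_s_entry hr) (negPf kj) mulr0 subr0.
have := p j; rewrite h (rootv1 hW gA hr); case: (root_unit hW hr h) => ->.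
  by rewrite scale1r.
by rewrite scaleE basisE eqxx mulr1 oppr_ge0 ler10.
Qed.

(** One root is added for each letter of a word for [u]. *)
Lemma inversions_finite u : exists L : seq 'cV[R]_n, forall x i,
  posv (rootv x i) -> negv (rho u *m rootv x i) -> rootv x i \in L.
Proof.
have [w <-] := all_gen hW u; elim: w => [|j w [L hL]] /=.
  exists [::] => x i p; rewrite (rho1 hW gA hr) mul1mx => q.
  by have := root_neq0 hW gA hr x i; rewrite (posv_negv p q) eqxx.
exists ((rho (wprod s w)^-1%g *m basis j) :: L) => x i p.
rewrite (repM hr) -mulmxA -(rootvM hr) => q; rewrite inE.
case: (root_sign hW hm gA hr (wprod s w * x)%g i) => h.
  have := simple_of_sign_change h q; rewrite (rootvM hr) => <-.
  by rewrite mulmxA (rhoVK hW gA hr) mul1mx eqxx.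
by rewrite hL ?orbT // -(rootvM hr).
Qed.

(** The list may contain further vectors, so that lists can be enlarged freely. *)
Definition finite_above K k := exists L : seq 'cV[R]_n, forall x i,
  inW s K x -> i \in K -> posv (rootv x i) -> 0 < rootv x i k 0 ->
  rootv x i \in L.

(** A positive root involving [j] either involves [i], or is the image under
    [s i] of one which does. *)
Lemma finite_above_step K i j : i \in K -> i != j -> A i j != 0 ->
  finite_above K i -> finite_above K j.
Proof.
move=> iK ij aij [L hL]; exists (L ++ map (mulmx (rho (s i))) L) => x k xK kK p pj.
rewrite mem_cat; have [pi|pi] := ltP 0 (rootv x k i 0); first by rewrite hL.
have pi0 : rootv x k i 0 = 0 by apply/eqP; rewrite eq_le pi p.
have ji : j != i by rewrite eq_sym.
have [q qi] := support_step p pj pi0 aij ji.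
apply/orP; right; apply/mapP; exists (rootv (s i * x)%g k).
  rewrite hL ?(rootvM hr) //.
  by apply: inWM => //; apply: inW_s.
by rewrite (rootvM hr) mulmxA -(repM hr) (sK hW) (rho1 hW gA hr) mul1mx.
Qed.

(** The roots of [W_K] being finite in number, choose [w] making as many positive
    roots as possible negative.  If some [rootv w k] were positive, [w * s k]
    would do better, because [s k] permutes the positive roots other than
    [basis k]. *)
Lemma longest_element K : (forall k, k \in K -> finite_above K k) ->
  exists2 w, inW s K w & forall k, k \in K -> negv (rootv w k).
Proof.
move=> hK.
have [L hL] : exists L : seq 'cV[R]_n, forall x i,
    inW s K x -> i \in K -> posv (rootv x i) -> rootv x i \in L.
  have /choice[f hf] : forall k, exists Lk : seq 'cV[R]_n, k \in K ->
      forall x i, inW s K x -> i \in K -> posv (rootv x i) ->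
      0 < rootv x i k 0 -> rootv x i \in Lk.
    move=> k; have [kK|kK] := boolP (k \in K); last by exists [::].
    by have [L hL] := hK k kK; exists L.
  exists (flatten [seq f k | k <- enum 'I_n]) => x i xK iK p.
  have [k pk] : exists k, 0 < rootv x i k 0.
    apply: contrapT => no; have := root_neq0 hW gA hr x i.
    rewrite (_ : rootv x i = 0) ?eqxx //; apply: posv_negv => // k.
    by rewrite leNgt; apply/negP => h; apply: no; exists k.
  have kK : k \in K.
    apply: contraT => kK; move: pk.
    by rewrite (root_supp hW gA hr xK iK kK) ltxx.
  apply/flattenP; exists (f k); last exact: hf.
  by apply/mapP; exists k; rewrite ?mem_enum.
pose isroot (v : 'cV[R]_n) := `[< exists x i, [/\ inW s K x, i \in K, posv v & v = rootv x i] >].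
pose P := [seq v <- undup L | isroot v].
have PP v : reflect (exists x i, [/\ inW s K x, i \in K, posv v & v = rootv x i]) (v \in P).
  rewrite mem_filter mem_undup; apply: (iffP andP) => [[/asboolP h _]|h] //.
  split; first exact/asboolP.
  by case: h => x [i [xK iK p e]]; rewrite e hL // -e.
have uP : uniq P by rewrite filter_uniq // undup_uniq.
pose neg w := [seq v <- P | `[< negv (rho w *m v) >]].
have grow w k : inW s K w -> k \in K -> posv (rootv w k) ->
    (size (neg w) < size (neg (w * s k)%g))%N.
  move=> wK kK p.
  suff: (size (basis k :: map (mulmx (rho (s k))) (neg w)) <= size (neg (w * s k)%g))%N.
    by rewrite /= size_map.
  have sI : injective (mulmx (rho (s k)) : 'cV_n -> 'cV_n).
    apply: (can_inj (g := mulmx (rho (s k)))) => v.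
    by rewrite mulmxA -(repM hr) (sK hW) (rho1 hW gA hr) mul1mx.
  have negP v : v \in neg w -> v \in P /\ negv (rho w *m v).
    by rewrite mem_filter => /andP[/asboolP].
  apply: uniq_leq_size => /=.
    rewrite map_inj_uniq // filter_uniq // andbT; apply/mapP => -[v /negP[vP vn] kv].
    have := PP v vP => -[x [i [xK iK pv vE]]].
    have : 0 <= v k 0 by [].
    have -> : v = - basis k.
      rewrite -(rep_s_basis hW gA hr) kv mulmxA -(repM hr) (sK hW).
      by rewrite (rho1 hW gA hr) mul1mx.
    by rewrite mxE basisE eqxx oppr_ge0 ler10.
  have wsk v : rho (w * s k)%g *m (rho (s k) *m v) = rho w *m v.
    by rewrite mulmxA -(repM hr) -mulgA (sK hW) mulg1.
  move=> v; rewrite inE => /orP[/eqP->|/mapP[v' /negP[v'P v'n] ->]].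
    rewrite mem_filter; apply/andP; split.
      apply/asboolP; rewrite (repM hr) -mulmxA (rep_s_basis hW gA hr) mulmxN => l.
      by rewrite mxE oppr_le0.
    apply/PP; exists 1%g, k; split=> //; first exact: inW1.
      by move=> l; rewrite basisE ler0n.
    by rewrite (rootv1 hW gA hr).
  rewrite mem_filter wsk; apply/andP; split; first exact/asboolP.
  have [x [i [xK iK pv' v'E]]] := PP _ v'P.
  apply/PP; exists (s k * x)%g, i; split=> //.
  - by apply: inWM => //; apply: inW_s.
  - rewrite v'E -(rootvM hr).
    case: (root_sign hW hm gA hr (s k * x)%g i) => //.
    rewrite (rootvM hr) -v'E => q.
    have e := simple_of_sign_change (x := x) (i := i) (j := k).
    rewrite -v'E in e; have {}e := e pv' q.
    have := root_neq0 hW gA hr w k; move: v'n; rewrite e => v'n.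
    by rewrite (@posv_negv _ _ (rootv w k)) ?eqxx.
  - by rewrite v'E (rootvM hr).
have key N : forall w, inW s K w -> (size P - size (neg w) <= N)%N ->
    exists2 w, inW s K w & forall k, k \in K -> negv (rootv w k).
  have bound w : (size (neg w) <= size P)%N by rewrite size_filter count_size.
  elim: N => [|N IH] w wK le.
    exists w => // k kK; case: (root_sign hW hm gA hr w k) => // p.
    by have := grow w k wK kK p; have := bound (w * s k)%g; lia.
  have [h|/existsNP[k /not_implyP[kK kn]]] := EM (forall k, k \in K -> negv (rootv w k)).
    by exists w.
  have p : posv (rootv w k) by case: (root_sign hW hm gA hr w k).
  apply: (IH (w * s k)%g); first by apply: inWM => //; apply: inW_s.
  by have := grow w k wK kK p; have := bound (w * s k)%g; lia.
exact: (key _ 1%g (inW1 _ _) (leqnn _)).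
Qed.

Lemma basis_expand K w k : inW s K w -> k \in K ->
  basis k = \sum_(j in K) rootv w^-1%g k j 0 *: rootv w j.
Proof.
move=> wK kK.
rewrite [LHS](_ : _ = rho w *m rootv w^-1%g k); last first.
  by rewrite /rootv mulmxA (rhoKV hW gA hr) mul1mx.
rewrite {1}(@sum_supp _ _ K (rootv w^-1%g k)).
  by rewrite mulmx_sumr; apply: eq_bigr => j _; rewrite -scalemxAr.
by move=> j jK; apply: (root_supp hW gA hr (inWV hW wK)).
Qed.

Lemma longest_inv K w : inW s K w -> (forall k, k \in K -> negv (rootv w k)) ->
  forall k, k \in K -> negv (rootv w^-1%g k).
Proof.
move=> wK wn k kK; have wK' := inWV hW wK.
case: (root_sign hW hm gA hr w^-1%g k) => // p.
have e := basis_expand wK kK.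
have := congr1 (fun v : 'cV_n => v k 0) e; rewrite basisE eqxx summxE => h.
have : (1 : R) <= 0.
  rewrite (h : 1 = _) sumr_le0 // => j jK; rewrite scaleE.
  by apply: mulr_ge0_le0; [apply: p | apply: wn].
by rewrite ler10.
Qed.

(** Up to sign [w] and its inverse both preserve the cone spanned by the simple
    roots of [K], so they permute its extremal rays. *)
Lemma longest_permutes K w : inW s K w ->
  (forall k, k \in K -> negv (rootv w k)) ->
  forall k, k \in K -> exists2 j, j \in K & (s k = w * s j * w^-1)%g.
Proof.
move=> wK wn k kK; have wK' := inWV hW wK; have wn' := longest_inv wK wn.
have e := basis_expand wK kK.
have [|j jK [_ [d hd]]] := basis_extremal hW gA hr e.
  move=> j jK l; rewrite scaleE.
  by apply: mulr_le0; [apply: wn' | apply: wn].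
by exists j => //; rewrite (conj_eq_simple hW hm gA hr hd).
Qed.

End LongestElement.

(** * Adding one reflection *)

Section MorphOrder.
Variables (W : groupType) (n : nat) (s : 'I_n -> W) (m : 'M[nat]_n).
Hypothesis hW : coxeter_system s m.
Variable alpha : W -> W.
Hypothesis alphaM : {morph alpha : x y / (x * y)%g}.
Hypothesis alphaI : injective alpha.

Lemma morph_order v i j a b :
  (alpha (s i) = v * s a * v^-1)%g -> (alpha (s j) = v * s b * v^-1)%g ->
  m a b = m i j.
Proof.
move=> hi hj; apply: (has_order_inj (cox_order hW a b)) => k.
have aX x l : (alpha (x ^+ l) = alpha x ^+ l)%g.
  elim: l => [|l IH]; first exact: (morph1 alphaM).
  by rewrite !expgS alphaM IH.
have cX x l : ((v * x * v^-1) ^+ l = v * x ^+ l * v^-1)%g.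
  elim: l => [|l IH]; first by rewrite mulg1 mulgV.
  by rewrite !expgS IH !mulgA mulgVK.
have e : (alpha ((s i * s j) ^+ k) = v * (s a * s b) ^+ k * v^-1)%g.
  by rewrite aX alphaM hi hj -cX !mulgA mulgVK.
have [h1 h2] := cox_order hW i j k; split=> [e1|/h2 e1].
  apply: h1; apply: alphaI; rewrite e e1 (morph1 alphaM).
  by rewrite mulg1 mulgV.
move: e; rewrite e1 (morph1 alphaM) => /(congr1 (fun z => v^-1 * z * v)%g).
by rewrite !mulgA mulVg mul1g mulgVK mulg1 mulVg.
Qed.

End MorphOrder.

(** The hypotheses on [v], [t], [s0], [w] are the conclusions of [normal_form].
    All pairings are taken on the side of [K]: [y] is the preimage of [u] under
    [alpha], up to conjugation, and [y * s i0 * y^-1] the one of [s s0]. *)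
Section Extension.
Variables (W : groupType) (n : nat) (s : 'I_n -> W) (m : 'M[nat]_n).
Hypothesis hW : coxeter_system s m.
Hypothesis hm : crystallographic m.
Variables alpha beta : W -> W.
Hypothesis alphaM : {morph alpha : x y / (x * y)%g}.
Hypothesis betaM : {morph beta : x y / (x * y)%g}.
Hypothesis alphaK : cancel alpha beta.
Hypothesis betaK : cancel beta alpha.
Hypothesis alphaPP : preserves_parabolics s alpha.
Hypothesis betaPP : preserves_parabolics s beta.

Variables (K : {set 'I_n}) (i0 : 'I_n).
Hypothesis i0K : i0 \notin K.
Variables (v : W) (t : 'I_n -> 'I_n) (s0 : 'I_n) (w : seq 'I_n).
Let u := wprod s (map t w).
Hypothesis ht : forall i, i \in K -> (alpha (s i) = v * s (t i) * v^-1)%g.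
Hypothesis s0K : s0 \notin (t @: K).
Hypothesis wK : all (mem K) w.
Hypothesis hi0 : (alpha (s i0) = v * (u^-1 * s s0 * u) * v^-1)%g.
Let y := wprod s w.

Variable R : rcfType.
Local Notation A := (sym_gcm m R).
Let gA : gcm m A := sym_gcmP hW R.
Variables (rho : W -> 'M[R]_n) (hr : representation s A rho).
Local Notation rootv := (rootv rho).
Local Notation bform := (bform m).

Let yK : inW s K y. Proof. by exists w. Qed.

Let alpha_y : (alpha y = v * u * v^-1)%g.
Proof. exact: (morph_word alphaM ht wK). Qed.

Let t_s0 i : i \in K -> s0 != t i.
Proof. by move=> iK; apply: contraNneq s0K => ->; apply: imset_f. Qed.

Let t_i0 i : i \in K -> i0 != i.
Proof. by move=> iK; apply: contraNneq i0K => ->. Qed.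

Let mt i j : i \in K -> j \in K -> A (t i) (t j) = A i j.
Proof.
move=> iK jK; have [->|ij] := eqVneq i j; first by rewrite !(gcm_diag gA).
apply: sym_gcm_off => //; last exact: (morph_order hW alphaM (alpha_inj alphaK) (ht iK) (ht jK)).
apply: contraNneq ij => e; apply/eqP; apply: (cox_inj hW).
by apply: (alpha_inj alphaK); rewrite !ht // e.
Qed.

Let g := rootv u^-1%g s0.
Let pairing i := bform (rootv y i0) (basis i).

(** The root [g] is, up to [v], the one of the image of [s i0], and the images of
    [s i0] and [s i] are simultaneously conjugate to simple reflections. *)
Let form_g i : i \in K -> `|bform g (basis (t i))| = - A i0 i.
Proof.
move=> iK.
have [w' [t' h']] := simple_up_to_conj2 hW hm alphaM alphaK alphaPP i0 i.
have h1 := h' i0; rewrite inE set11 in h1; have {}h1 := h1 erefl.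
have h2 := h' i; rewrite !inE eqxx orbT in h2; have {h' h2}h2 := h2 erefl.
rewrite -(form_rho hW hr v) /g -(rootvM hr).
apply: (form_pair hW hr (w := w') (a := t' i0) (b := t' i)) => //.
- exact: t_i0.
- apply: contraNneq (t_i0 iK) => e; apply/eqP; apply: (cox_inj hW).
  by apply: (alpha_inj alphaK); rewrite h1 h2 e.
- exact: (morph_order hW alphaM (alpha_inj alphaK) h1 h2).
- by rewrite -h1 hi0 invgM invgK !mulgA.
- by rewrite -h2 ht.
Qed.

Let conj_y : (y * s i0 * y^-1 = beta (v * s s0 * v^-1))%g.
Proof.
rewrite -[LHS]alphaK; congr beta.
rewrite !alphaM (morphV alphaM) alpha_y hi0 !invgM !invgK.
by rewrite !mulgA !mulgVK !mulgK.
Qed.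

(** The same statement for the inverse automorphism, which relates the pairs
    consisting of [s s0] and [s (t i)] to their preimages. *)
Let abs_pairing i : i \in K -> `|pairing i| = - A s0 (t i).
Proof.
move=> iK; have bI := alpha_inj betaK.
have [w' [t' h']] := simple_up_to_conj2 hW hm betaM betaK betaPP s0 (t i).
have h1 := h' s0; rewrite !inE eqxx in h1; have {}h1 := h1 erefl.
have h2 := h' (t i); rewrite !inE eqxx orbT in h2; have {h' h2}h2 := h2 erefl.
rewrite /pairing -(rootv1 hW gA hr i).
apply: (form_pair hW hr (w := (beta v * w')%g) (a := t' s0) (b := t' (t i))).
- exact: t_s0.
- apply: contraNneq (t_s0 iK) => e; apply/eqP; apply: (cox_inj hW).
  by apply: bI; rewrite h1 h2 e.
- exact: (morph_order hW betaM bI h1 h2).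
- by rewrite conj_y !betaM (morphV betaM) h1 invgM !mulgA.
- rewrite mul1g invg1 mulg1 -[LHS]alphaK ht // !betaM (morphV betaM) h2 invgM.
  by rewrite !mulgA.
Qed.

(** The two weights of [W_K] to be compared: the one of [g], transported by [t],
    and the one of the simple root of [s i0]. *)
Let f1 : 'rV[R]_n := \row_i bform g (basis (t i)).
Let f2 : 'rV[R]_n := row i0 A.

(** The action of a word in [K] on weights depends only on the entries of the
    Cartan matrix inside [K], so it commutes with the transport by [t]. *)
Let f1_word w' i : all (mem K) w' -> i \in K ->
  (f1 *m rho (wprod s w')^-1%g) 0 i =
  bform (rho (wprod s (map t w')) *m g) (basis (t i)).
Proof.
move=> + iK; elim: w' i iK => [|j w' IH] i iK /=.
  by rewrite invg1 (rho1 hW gA hr) mulmx1 mul1mx mxE.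
case/andP=> jK hw'.
rewrite invgM (sV hW) (repM hr (wprod s w')^-1%g) mulmxA (repS hr j) refl_mulr.
rewrite mul_basis (repM hr (s (t j))) -[in RHS]mulmxA (form_rhoV hW hr) (sV hW) (rep_s_mul hr) mul_basis.
have -> (a b : 'rV[R]_n) c : (a - c *: b) 0 i = a 0 i - c * b 0 i by rewrite !mxE.
by rewrite !IH // mxE mt // form_subr [_ * A j i]mulrC.
Qed.

Let f1_y i : i \in K -> (f1 *m rho y^-1%g) 0 i = A s0 (t i).
Proof.
move=> iK; rewrite f1_word // /g mulmxA -(repM hr) mulgV (rho1 hW gA hr) mul1mx.
exact: form_bb.
Qed.

Let f2_y i : (f2 *m rho y^-1%g) 0 i = pairing i.
Proof.
by rewrite row_mulE /pairing (form_rhoV hW hr) form_basis mulmxA mul_basis.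
Qed.

Let f1D i : i \in K -> `|f1 0 i| = - f2 0 i.
Proof. by move=> iK; rewrite [f1 _ _]mxE form_g // [f2 _ _]mxE. Qed.

Let f := f1 + f2.

Let f_le0 i : i \in K -> f 0 i <= 0.
Proof.
by rewrite /f mxE => iK; have := f1D iK; have := ler_norm (f1 0 i); lra.
Qed.

Let f_y i : i \in K -> (f *m rho y^-1%g) 0 i = A s0 (t i) + pairing i.
Proof. by move=> iK; rewrite mulmxDl mxE f1_y // f2_y. Qed.

(** Both [f] and its image are antidominant, each being the sum of two weights
    equal up to signs of which one is antidominant. *)
Let f_fixed : f *m rho y^-1%g = f.
Proof.
have h : inW s [set i in K | f 0 i == 0] y.
  apply: (antidominant_stab hW hm gA hr yK f_le0) => i iK.
  by have := abs_pairing iK; have := ler_norm (pairing i); rewrite f_y //; lra.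
exact: (stab_functional hW gA hr (inWV hW h)).
Qed.

Let eval_supp (h : 'rV[R]_n) x k : inW s K x -> k \in K ->
  (h *m rootv x k) 0 0 = \sum_(i in K) rootv x k i 0 * h 0 i.
Proof.
move=> xK kK; rewrite mxE (bigID (mem K)) /= [X in _ + X]big1 ?addr0.
  by apply: eq_bigr => i _; rewrite mulrC.
by move=> i iK; rewrite (root_supp hW gA hr xK kK iK) mulr0.
Qed.

(** Consider a positive root involving [i] and [j], with pairings of opposite
    signs at [i] and [j], and move it by the inverse of [y].  As [f] is fixed by
    [y], its value on the root remains negative; as [f] is antidominant, the root
    remains positive by sign-coherence.  But [f1 - f2] is dominant while its image under [y] is
    antidominant and nonzero at [j]: on the moved root it is both nonnegative and
    negative. *)
Lemma pairing_sign x k i j : inW s K x -> k \in K -> posv (rootv x k) ->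
  i \in K -> j \in K -> 0 < rootv x k i 0 -> 0 < rootv x k j 0 ->
  pairing i < 0 -> pairing j <= 0.
Proof.
move=> xK kK p iK jK xi xj pi; rewrite leNgt; apply/negP => pj.
have yxK : inW s K (y^-1 * x)%g by apply: inWM => //; apply: (inWV hW).
have eval (h : 'rV[R]_n) : (h *m rootv (y^-1 * x)%g k) 0 0 =
    ((h *m rho y^-1%g) *m rootv x k) 0 0 by rewrite (rootvM hr) mulmxA.
have f_neg : (f *m rootv (y^-1 * x)%g k) 0 0 < 0.
  rewrite eval f_fixed eval_supp // (bigD1 i) //=; apply: ltr_wnDr.
    by apply: sumr_le0 => l /andP[lK _]; rewrite mulr_ge0_le0 ?f_le0.
  rewrite pmulr_rlt0 // -f_fixed f_y //.
  by have := abs_pairing iK; rewrite ltr0_norm // => h; lra.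
have q : posv (rootv (y^-1 * x)%g k).
  case: (root_sign hW hm gA hr (y^-1 * x)%g k) => // q.
  move: f_neg; rewrite ltNge eval_supp // sumr_ge0 // => l lK.
  by rewrite mulr_le0 ?f_le0.
have h_pos : 0 <= ((f1 - f2) *m rootv (y^-1 * x)%g k) 0 0.
  rewrite eval_supp // sumr_ge0 // => l lK; rewrite mulr_ge0 //.
  have -> : (f1 - f2) 0 l = f1 0 l - f2 0 l by rewrite mxE [(- f2) 0 l]mxE.
  by have := f1D lK; have := ler_norm (- f1 0 l); rewrite normrN; lra.
move: h_pos; rewrite eval mulmxBl leNgt => /negP; apply.
have hl l : l \in K -> (f1 *m rho y^-1%g - f2 *m rho y^-1%g) 0 l = A s0 (t l) - pairing l.
  by move=> lK; rewrite mxE f1_y // [X in _ + X]mxE f2_y.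
rewrite eval_supp // (bigD1 j) //=; apply: ltr_wnDr.
  apply: sumr_le0 => l /andP[lK _]; rewrite mulr_ge0_le0 // hl //.
  by have := abs_pairing lK; have := ler_norm (- pairing l); rewrite normrN; lra.
by rewrite pmulr_rlt0 // hl //; have := abs_pairing jK; rewrite gtr0_norm //; lra.
Qed.

Let adj : rel 'I_n := [rel i j | [&& i \in K, j \in K, i != j & A i j != 0]].

(** Along a path the support of a root can be extended vertex by vertex. *)
Let connected_root i j : i \in K -> connect adj i j ->
  exists x k, [/\ inW s K x, k \in K, posv (rootv x k),
    0 < rootv x k i 0 & 0 < rootv x k j 0].
Proof.
move=> iK /connectP[p hp ->] {j}.
have step q a : path adj a q -> (exists x k, [/\ inW s K x, k \in K,
      posv (rootv x k), 0 < rootv x k i 0 & 0 < rootv x k a 0]) ->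
    exists x k, [/\ inW s K x, k \in K,
      posv (rootv x k), 0 < rootv x k i 0 & 0 < rootv x k (last a q) 0].
  elim: q a => [//|b q IH] a /= /andP[/and4P[aK bK ab Aab] hq].
  move=> [x [k [xK kK px xi xa]]]; apply: IH hq _.
  have [xb|xb] := ltP 0 (rootv x k b 0); first by exists x, k.
  have xb0 : rootv x k b 0 = 0 by apply/eqP; rewrite eq_le xb px.
  have Aba : A b a != 0 by rewrite (sym_gcm_sym hW).
  have [px' xb'] := support_step hW hr px xa xb0 Aba ab.
  exists (s b * x)%g, k; rewrite (rootvM hr); split=> //.
    by apply: inWM => //; apply: inW_s.
  rewrite (rep_s_entry hr); case: eqP => [e|_]; last by rewrite mulr0 subr0.
  by rewrite e xb0 ltxx in xi.
apply: step hp _; exists 1%g, i; rewrite (rootv1 hW gA hr) !basisE eqxx ltr01.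
split=> //; first exact: inW1.
by move=> k; rewrite basisE ler0n.
Qed.

(** The components of [K] on which some pairing is positive. *)
Let L := [set j in K | [exists i in K, (0 < pairing i) && connect adj i j]].

Let LK j : j \in L -> j \in K. Proof. by rewrite inE => /andP[]. Qed.

Let pairing_L j : j \in L -> 0 <= pairing j.
Proof.
rewrite inE => /andP[jK /existsP[i /and3P[iK pi cij]]].
have [x [k [xK kK p xi xj]]] := connected_root iK cij.
rewrite leNgt; apply/negP => pj.
by have := pairing_sign xK kK p jK iK xj xi pj; rewrite leNgt pi.
Qed.

Let pairing_KL j : j \in K -> j \notin L -> pairing j <= 0.
Proof.
move=> jK; rewrite inE jK /= leNgt; apply: contra => pj.
by apply/existsP; exists j; rewrite jK pj connect0.
Qed.

Let A_KL i j : i \in L -> j \in K -> j \notin L -> A i j = 0.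
Proof.
move=> iL jK jL; apply/eqP; apply: contraR jL => Aij.
have iK := LK iL; have [<-//|ij] := eqVneq i j.
move: iL; rewrite inE => /andP[_ /existsP[l /and3P[lK pl cli]]].
rewrite inE jK /=.
apply/existsP; exists l; rewrite lK pl (connect_trans cli) //.
by apply: connect1; rewrite /adj /= iK jK ij.
Qed.

Let form_supp J x k : inW s J x -> k \in J ->
  bform (rootv y i0) (rootv x k) = \sum_(i in J) rootv x k i 0 * pairing i.
Proof.
move=> xJ kJ; rewrite form_sum (bigID (mem J)) /= [X in _ + X]big1 ?addr0 // => i iJ.
by rewrite (root_supp hW gA hr xJ kJ iJ) mul0r.
Qed.

(** Roots of [W_L] involving [i] have a positive pairing with [rootv y i0], so
    the inverse of [y] makes them negative: a positive vector supported on [K]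
    has a nonpositive pairing with the simple root of [s i0]. *)
Let finite_pos i : i \in L -> 0 < pairing i -> finite_above s rho L i.
Proof.
move=> iL pi; have [P hP] := inversions_finite hW hm hr y^-1%g.
exists P => x k xL kL q qi; apply: hP => //.
have xK : inW s K x by apply: inW_sub xL; apply/fintype.subsetP.
have yxK : inW s K (y^-1 * x)%g by apply: inWM => //; apply: (inWV hW).
rewrite -(rootvM hr); case: (root_sign hW hm gA hr (y^-1 * x)%g k) => // q'.
have : 0 < bform (rootv y i0) (rootv x k).
  rewrite (form_supp xL kL) (bigD1 i) //=; apply: ltr_wpDr; last exact: mulr_gt0.
  by apply: sumr_ge0 => j /andP[jL _]; rewrite mulr_ge0 ?pairing_L.
rewrite (form_rhoV hW hr) -(rootvM hr) form_basis ltNge => /negP[].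
rewrite mxE; apply: sumr_le0 => j _; have [jK|jK] := boolP (j \in K).
  by rewrite mulr_le0_ge0 // (gcm_le0 gA) // t_i0.
by rewrite (root_supp hW gA hr yxK (LK kL) jK) mulr0.
Qed.

Let finite_L j : j \in L -> finite_above s rho L j.
Proof.
move=> jL; move: (jL); rewrite inE => /andP[jK /existsP[i /and3P[iK pi /connectP[p hp ej]]]].
have iL : i \in L by rewrite inE iK; apply/existsP; exists i; rewrite iK pi connect0.
have : finite_above s rho L i by exact: finite_pos.
rewrite ej; elim: p i iL hp {iK pi ej} => [//|b p IH] a aL /= /andP[/and4P[aK bK ab Aab] hp] fa.
have bL : b \in L.
  by apply: contraT => bL; rewrite (A_KL aL bK bL) eqxx in Aab.
by apply: IH hp _ => //; apply: (finite_above_step hW hr aL ab Aab fa).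
Qed.

(** The longest element [z] of [W_L] makes [rootv y i0] antidominant on [K]; the
    simple root of [s i0] is in the same orbit and antidominant too, so the two
    are equal.  Thus conjugation by [z * y] fixes [s i0], and conjugation by [z]
    permutes the simple reflections of [K]. *)
Lemma extend : simple_up_to_conj s alpha (i0 |: K).
Proof.
have [z zL zn] := longest_element hW hm hr finite_L.
have zK : inW s K z by apply: inW_sub zL; apply/fintype.subsetP.
have zn' := longest_inv hW hm hr zL zn.
have z_fix i : i \in K -> i \notin L -> forall x, inW s L x ->
    rho x *m basis i = basis i :> 'cV[R]_n.
  move=> iK iL x [w' hw <-]; elim: w' hw => [_|j w' IH] /=.
    by rewrite (rho1 hW gA hr) mul1mx.
  case/andP=> jL hw.
  rewrite (repM hr) -mulmxA IH // (rep_s_mul hr) mul_basis.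
  by rewrite A_KL // scale0r subr0.
have perm i : i \in K -> exists2 j, j \in K & (s i = z * s j * z^-1)%g.
  move=> iK; have [iL|iL] := boolP (i \in L).
    by have [j jL e] := longest_permutes hW hm hr zL zn iL; exists j => //; apply: LK.
  exists i => //; rewrite (@conj_eq_simple _ _ _ _ hW hm _ _ gA _ hr z i i 1) //.
  by rewrite scale1r; apply: z_fix.
have zy : (z * y * s i0 * (z * y)^-1)%g = s i0.
  have : inW s [set i in K | (row i0 A) 0 i == 0] (z * y)%g.
    apply: (antidominant_stab hW hm gA hr).
    - exact: inWM.
    - by move=> i iK; rewrite mxE (gcm_le0 gA) // t_i0.
    move=> i iK; rewrite row_mulE -(mul_basis (A *m _)) -mulmxA -form_basis.
    rewrite invgM (repM hr) -mulmxA -(form_rhoV hW hr).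
    have [iL|iL] := boolP (i \in L); last first.
      by rewrite (z_fix i iK iL) ?pairing_KL //; apply: (inWV hW).
    rewrite (form_supp (inWV hW zL) iL); apply: sumr_le0 => j jL.
    by rewrite mulr_le0_ge0 ?pairing_L //; apply: zn'.
  case=> w' hw e; apply: (@conj_eq_simple _ _ _ _ hW hm _ _ gA _ hr _ _ _ 1).
  rewrite scale1r -e /rootv; elim: w' hw {e} => [_|j w' IH] /=.
    by rewrite (rho1 hW gA hr) mul1mx.
  case/andP; rewrite !inE => /andP[jK /eqP ij] hw.
  rewrite (repM hr) -mulmxA IH // (rep_s_mul hr) mul_basis (sym_gcm_sym hW).
  by move: ij; rewrite mxE => ->; rewrite scale0r subr0.
pose p i := odflt i [pick j | (j \in K) && (s i == z * s j * z^-1)%g].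
have hp i : i \in K -> p i \in K /\ (s i = z * s (p i) * z^-1)%g.
  move=> iK; rewrite /p; case: pickP => [j /andP[jK /eqP]|no] //.
  by have [j jK e] := perm i iK; have := no j; rewrite jK -e eqxx.
exists (alpha z * v)%g, (fun i => if i == i0 then s0 else t (p i)) => i.
rewrite !inE => /orP[/eqP->|iK].
  rewrite eqxx -{1}zy.
  have -> : (z * y * s i0 * (z * y)^-1 = z * (y * s i0 * y^-1) * z^-1)%g.
    by rewrite invgM !mulgA.
  by rewrite conj_y !alphaM betaK (morphV alphaM) invgM !mulgA.
rewrite eq_sym (negPf (t_i0 iK)); have [pK e] := hp i iK.
by rewrite {1}e !alphaM (morphV alphaM) ht // invgM !mulgA.
Qed.
End Extension.

(** * Conclusion *)

Section Conclusion.
Variables (W : groupType) (n : nat) (s : 'I_n -> W) (m : 'M[nat]_n).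
Hypothesis hW : coxeter_system s m.
Local Open Scope classical_set_scope.

Lemma generated_subgroup (X : set W) : is_subgroup (generated X).
Proof.
split=> [B [[B1 _ _] _] //|x y hx hy B hB|x hx B hB].
  by case: (hB) => -[_ BM _] _; apply: BM; [apply: hx|apply: hy].
by case: (hB) => -[_ _ BV] _; apply: BV; apply: hx.
Qed.

Lemma sub_generated (X : set W) : X `<=` generated X.
Proof. by move=> x Xx B [_]; apply. Qed.

Lemma image_generated (f : W -> W) (X : set W) :
  {morph f : x y / (x * y)%g} -> f @` generated X = generated (f @` X).
Proof.
move=> fM; have [g1 gM gV] := generated_subgroup (f @` X).
have [h1 hM hV] := generated_subgroup X.
apply/seteqP; split=> [_ [x hx <-]|x hx].
  apply: (hx [set x | generated (f @` X) (f x)]); split.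
    split=> [|y z hy hz|y hy] /=; rewrite ?(morph1 fM) ?fM ?(morphV fM) //.
      exact: gM.
    exact: gV.
  by move=> y Xy; apply: sub_generated; exists y.
apply: hx; split.
  split=> [|_ _ [y hy <-] [z hz <-]|_ [y hy <-]].
  - by exists 1%g => //; rewrite (morph1 fM).
  - by exists (y * z)%g; [apply: hM|rewrite fM].
  - by exists y^-1%g; [apply: hV|rewrite (morphV fM)].
by move=> _ [y Xy <-]; exists y => //; apply: sub_generated.
Qed.

Lemma generated_conj v (X : set W) :
  generated (conj_set v X) = conj_set v (generated X).
Proof.
apply/esym/image_generated => x y.
by rewrite !mulgA mulgVK.
Qed.

Lemma generated_std (J : set W) : J `<=` range s ->
  generated J = std s [set j | `[< J (s j) >]]%SET.
Proof.
move=> JS; rewrite /std -(generatedE hW); congr generated.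
apply/seteqP; split=> [x Jx|_ [j /= + <-]]; last by rewrite inE => /asboolP.
have [j _ e] := JS x Jx; exists j => //=.
by rewrite inE; apply/asboolP; rewrite e.
Qed.

Lemma std_parabolic K : parabolic (range s) (std s K).
Proof.
exists 1%g, [set s j | j in [set j | j \in K]]; split; last first.
  by rewrite conj_set1 (generatedE hW).
by move=> _ [j _ <-]; exists j.
Qed.

Lemma inner_by_graph_preserves (alpha : W -> W) (P : set W) :
  {morph alpha : x y / (x * y)%g} ->
  inner_by_graph (range s) alpha -> parabolic (range s) P ->
  parabolic (range s) (alpha @` P).
Proof.
move=> alphaM [w hw] [v [J [JS ->]]].
exists (alpha v * w)%g, (conj_set w^-1%g (alpha @` J)); split.
  move=> _ [_ [x Jx <-] <-].
  have : (alpha @` range s) (alpha x) by exists x => //; apply: JS.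
  rewrite hw => -[y ys <-].
  by rewrite invgK !mulgA mulVg mul1g mulgVK.
by rewrite (image_conj alphaM) image_generated // generated_conj -conj_setM mulgK.
Qed.

Hypothesis hm : crystallographic m.

Lemma simple_up_to_conj_all (alpha beta : W -> W) :
  {morph alpha : x y / (x * y)%g} -> {morph beta : x y / (x * y)%g} ->
  cancel alpha beta -> cancel beta alpha -> preserves_parabolics s alpha ->
  simple_up_to_conj s alpha [set: 'I_n]%SET.
Proof.
move=> alphaM betaM alphaK betaK alphaPP.
have betaPP := preserves_parabolics_inv alphaM betaM alphaK alphaPP.
have [rho hr] := representation_exists hW hm (sym_gcmP hW realalg).
have key N : forall K : {set 'I_n}, #|K| = N -> simple_up_to_conj s alpha K.
  elim: N => [K /cards0_eq->|N IH K cK].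
    by exists 1%g, id => i; rewrite inE.
  have [i iK] : exists i, i \in K by apply/card_gt0P; rewrite cK.
  rewrite -(finset.setD1K iK); have iK' : i \notin (K :\ i)%SET by rewrite finset.setD11.
  have cK' : #|(K :\ i)%SET| = N by move: cK; rewrite (cardsD1 i) iK => -[].
  have [v [t [s0 [w [ht s0K wK hi0]]]]] :=
    normal_form hW hm alphaM alphaK alphaPP iK' (IH _ cK').
  exact: (extend hW hm alphaM betaM alphaK betaK alphaPP betaPP iK' ht s0K wK hi0 hr).
exact: key.
Qed.

Lemma preserves_inner_by_graph (alpha : W -> W) :
  {morph alpha : x y / (x * y)%g} -> bijective alpha ->
  (forall P, parabolic (range s) P -> parabolic (range s) (alpha @` P)) ->
  inner_by_graph (range s) alpha.
Proof.
move=> alphaM [beta alphaK betaK] h.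
have betaM : {morph beta : x y / (x * y)%g}.
  by move=> x y; apply: (can_inj alphaK); rewrite alphaM !betaK.
have alphaPP : preserves_parabolics s alpha.
  move=> K; have [v [J [JS e]]] := h _ (std_parabolic K).
  by exists [set j | `[< J (s j) >]]%SET, v; rewrite e generated_std.
have [w [t ht]] := simple_up_to_conj_all alphaM betaM alphaK betaK alphaPP.
have tI : injective t.
  move=> i j e; apply: (cox_inj hW); apply: (can_inj alphaK).
  by rewrite !ht ?inE // e.
have [t' _ t'K] := injF_bij tI.
exists w; apply/seteqP; split=> [_ [_ [i _ <-] <-]|_ [_ [i _ <-] <-]].
  by rewrite ht ?inE //; exists (s (t i)).
by exists (s (t' i)) => //; rewrite ht ?inE // t'K.
Qed.
End Conclusion.

Local Close Scope ring_scope.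
Local Open Scope classical_set_scope.

Theorem corollary1p4 (W : groupType) (n : nat) (s : 'I_n -> W) (m : 'M[nat]_n)
    (hW : coxeter_system s m) (hm : crystallographic m)
    (alpha : {multiplicative W -> W}) (halpha : bijective alpha) :
  inner_by_graph (range s) alpha <->
  (forall P : set W, parabolic (range s) P -> parabolic (range s) (alpha @` P)).
Proof.
have alphaM : {morph alpha : x y / (x * y)%g} by exact: gmulfM.
split=> [h P|h]; first exact: inner_by_graph_preserves.
exact: (preserves_inner_by_graph hW hm).
Qed.
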